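(* Let $M$ be a closed oriented surface immersed in $\widetilde{SL}_2$, with mean curvature $H$ and induced area measure $d\mu$. Then its energy equals $$E(M)=\frac14\int_M\left(H^2+\frac5{16}\widehat K-\frac14\right)d\mu,$$ where $\widehat K$ at a point is the sectional curvature, in $\widetilde{SL}_2$, of the tangent plane to the surface at that point.
   Context: $\widetilde{SL}_2$ is the universal covering group of $SL(2,\mathbb{R})$, whose Lie algebra is realized (as $\mathfrak{su}(1,1)$) with basis $f_1=\begin{pmatrix}0&1\\1&0\end{pmatrix}$, $f_2=\begin{pmatrix}0&i\\-i&0\end{pmatrix}$, $f_3=\begin{pmatrix}i/2&0\\0&-i/2\end{pmatrix}$. The left-invariant metric is the one with $\langle f_j,f_k\rangle=4\delta_{jk}$, so that $e_j=\frac12f_j$ is an orthonormal basis, taken positively oriented; it satisfies $[e_1,e_2]=-2e_3$, $[e_1,e_3]=-\frac12e_2$, $[e_2,e_3]=\frac12e_1$. $\nabla$ is the Levi-Civita connection. Let $f:M\to\widetilde{SL}_2$ be the immersion, $z=x+iy$ a local conformal parameter compatible with the orientation, and $e^{2\alpha}dz\,d\bar z$ the induced metric, so $d\mu=e^{2\alpha}dx\wedge dy$. Write $f^{-1}f_z=\sum_{k=1}^3Z_ke_k$ (left translation to the Lie algebra). The generating spinor $\psi=(\psi_1,\psi_2)^{\top}$ (defined locally up to a common sign) is a smooth function with $$Z_1=\tfrac i2(\bar\psi_2^2+\psi_1^2),\quad Z_2=\tfrac12(\bar\psi_2^2-\psi_1^2),\quad Z_3=\psi_1\bar\psi_2,$$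 so $e^\alpha=|\psi_1|^2+|\psi_2|^2$. The unit normal $N$ is given by $$f^{-1}(N)=2ie^{-2\alpha}\left[(\bar Z_2Z_3-Z_2\bar Z_3)e_1+(\bar Z_3Z_1-Z_3\bar Z_1)e_2+(\bar Z_1Z_2-Z_1\bar Z_2)e_3\right]$$ and the mean curvature $H$ by $\nabla_{f_{\bar z}}f_z=\frac12e^{2\alpha}HN$. The spinor satisfies $\bar\partial\psi_1=V\psi_2$, $\partial\psi_2=-U\psi_1$ with potentials $$U=\frac H2\left(|\psi_1|^2+|\psi_2|^2\right)+i\left(\frac12|\psi_1|^2-\frac34|\psi_2|^2\right),\quad V=\frac H2\left(|\psi_1|^2+|\psi_2|^2\right)+i\left(\frac34|\psi_1|^2-\frac12|\psi_2|^2\right).$$ The form $UV\,dz\wedge d\bar z$ is a globally well-defined $2$-form on $M$, and the energy is $$E(M)=\int_MUV\,\frac{i\,dz\wedge d\bar z}2 .$$ *)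

(* Defs.v *)
From HB Require Import structures.
From mathcomp Require Import all_boot all_order all_algebra.
From mathcomp Require Import complex.
From mathcomp Require Import all_classical all_reals all_analysis.
From mathcomp Require Import ring lra.
Import Order.TTheory GRing.Theory Num.Theory numFieldNormedType.Exports.

Set Implicit Arguments.
Unset Strict Implicit.
Unset Printing Implicit Defensive.

Local Open Scope classical_set_scope.
Local Open Scope ring_scope.
Local Open Scope complex_scope.

Section Calculus.
Variable R : realType.
Implicit Types (g : R * R -> R) (h : R * R -> R[i]) (O : set (R * R)).

Definition dx g (p : R * R) : R := 'D_((1, 0) : R * R) g p.
Definition dy g (p : R * R) : R := 'D_((0, 1) : R * R) g p.

(* O is meant to be open *)
Fixpoint Ck (k : nat) O g : Prop :=
  (forall p, O p -> {for p, continuous g}) /\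
  (if k is k'.+1 then
     [/\ forall p, O p -> derivable g p ((1, 0) : R * R)
                       /\ derivable g p ((0, 1) : R * R),
         Ck k' O (dx g) & Ck k' O (dy g)]
   else True).

Definition smooth O g : Prop := forall k, Ck k O g.

Definition Re_ h (p : R * R) : R := complex.Re (h p).
Definition Im_ h (p : R * R) : R := complex.Im (h p).

Definition smoothC O h : Prop := smooth O (Re_ h) /\ smooth O (Im_ h).

(* d/d(zbar) = (d/dx + i d/dy)/2 *)
Definition dzbar h (p : R * R) : R[i] :=
  2^-1 * ((dx (Re_ h) p +i* dx (Im_ h) p) +
          'i * (dy (Re_ h) p +i* dy (Im_ h) p)).

Definition jacobian (t : R * R -> R * R) (p : R * R) : R :=
  dx (fst \o t) p * dy (snd \o t) p - dy (fst \o t) p * dx (snd \o t) p.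

Definition area2 : {measure set (measurableTypeR R * measurableTypeR R) -> \bar R} :=
  (lebesgue_measure \x lebesgue_measure)%E.

Definition integralC O h : R[i] :=
  (\int[area2]_(p in O) Re_ h p) +i* (\int[area2]_(p in O) Im_ h p).

End Calculus.

HB.mixin Record isTopologicalGroup G & Group G & Topological G := {
  mulg_continuous : continuous (fun xy : G * G => (xy.1 * xy.2)%g);
  invg_continuous : continuous (fun x : G => (x^-1)%g)
}.

#[short(type="topologicalGroupType")]
HB.structure Definition TopologicalGroup :=
  {G of isTopologicalGroup G & Group G & Topological G}.

Definition homeo_on (X Y : topologicalType) (A : set X) (B : set Y)
    (p : X -> Y) : Prop :=
  [/\ {within A, continuous p}, set_bij A B p &
      forall W, open W -> exists2 O, open O & p @` (A `&` W) = B `&` O].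

(* S carries the topology induced by Y *)
Definition covering_map (X Y : topologicalType) (S : set Y) (p : X -> Y)
    : Prop :=
  [/\ continuous p, range p = S &
      forall y, S y -> exists2 O, open_nbhs y O &
        exists (I : Type) (V : I -> set X),
          [/\ p @^-1` O = \bigcup_i V i,
              trivIset setT V &
              forall i, open (V i) /\ homeo_on (V i) (S `&` O) p]].

Section SimplyConnected.
Variables (R : realType) (X : topologicalType).

Definition path_connected : Prop :=
  forall a b : X, exists2 c : R -> X,
    {within `[0, 1], continuous c} & c 0 = a /\ c 1 = b.

Definition loops_contractible : Prop :=
  forall c : R -> X, {within `[0, 1], continuous c} -> c 0 = c 1 ->
  exists2 h : R * R -> X,
    {within `[0, 1] `*` `[0, 1], continuous h} &
    forall t, t \in `[0, 1] ->
      [/\ h (0, t) = c t, h (1, t) = c 0, h (t, 0) = c 0 & h (t, 1) = c 0].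

Definition simply_connected : Prop := path_connected /\ loops_contractible.

End SimplyConnected.

Definition SL2 (R : realType) : set 'M[R]_2 := [set A | \det A = 1].

Record universal_cover_SL2 (R : realType) := UniversalCoverSL2 {
  ucover :> topologicalGroupType;
  uproj : ucover -> 'M[R]_2;
  uprojM : forall a b : ucover, uproj (a * b)%g = uproj a *m uproj b;
  uproj_covering : covering_map (@SL2 R) uproj;
  ucover_simply_connected : simply_connected R ucover
}.

Lemma ord3_ind (P : 'I_3 -> Prop) : P 0 -> P 1 -> P (1+1) -> forall k, P k.
Proof.
move=> h0 h1 h2 [[|[|[|//]]] h]; first by rewrite (_ : Ordinal h = 0) //; apply/val_inj.
  by rewrite (_ : Ordinal h = 1) //; apply/val_inj.
by rewrite (_ : Ordinal h = 1+1) //; apply/val_inj.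
Qed.

Lemma sum_ord3 (V : nmodType) (F : 'I_3 -> V) : \sum_k F k = F 0 + F 1 + F (1+1).
Proof.
rewrite !big_ord_recl big_ord0 addr0 addrA.
by do ![congr (_ + _)|congr (F _)]; apply/val_inj.
Qed.

Lemma sum_ord33 (V : nmodType) (F : 'I_3 -> 'I_3 -> V) : \sum_j \sum_k F j k =
 (F 0 0 + F 0 1 + F 0 (1+1)) + (F 1 0 + F 1 1 + F 1 (1+1)) + (F (1+1) 0 + F (1+1) 1 + F (1+1) (1+1)).
Proof. by under eq_bigr do rewrite sum_ord3; rewrite sum_ord3. Qed.

Section LieAlgebra.
Variable R : realType.
Local Notation C := R[i].

Definition mx22 (T : Type) (a b c d : T) : 'M[T]_2 :=
  \matrix_(i, j) if i == 0 then (if j == 0 then a else b)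
                 else (if j == 0 then c else d).

(* f_1, f_2, f_3 and the orthonormal basis e_k = f_k / 2; the indices 1, 2, 3
   are 0, 1, 2 : 'I_3 throughout *)
Definition su11_f (k : 'I_3) : 'M[C]_2 :=
  if k == 0 then mx22 0 1 1 0
  else if k == 1 then mx22 0 'i (- 'i) 0
  else mx22 ('i / 2) 0 0 (- ('i / 2)).

Definition su11_e (k : 'I_3) : 'M[C]_2 := 2^-1 *: su11_f k.

Definition su11_coord (X : 'M[C]_2) : 'rV[R]_3 :=
  \row_k complex.Re (if k == 0 then X 0 1 + X 1 0
                     else if k == 1 then - 'i * (X 0 1 - X 1 0)
                     else - 'i * 4 * X 0 0).

Lemma half_realC : (2^-1 : R[i]) = (2^-1)%:C.
Proof. by rewrite fmorphV rmorphMn. Qed.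

Lemma su11_eE k : su11_e k =
  if k == 0 then mx22 0 (2^-1)%:C (2^-1)%:C 0
  else if k == 1 then mx22 0 (0 +i* 2^-1) (0 +i* - 2^-1) 0
  else mx22 (0 +i* 4^-1) 0 0 (0 +i* - 4^-1).
Proof.
have e : (2^-1 * 'i : R[i]) = 0 +i* 2^-1.
  by rewrite half_realC /=; congr (_ +i* _); rewrite ?mulr0 ?mul0r ?subr0 ?mulr1 ?addr0.
have e4 : (2^-1 * ('i / 2) : R[i]) = 0 +i* 4^-1.
  by rewrite mulrA e half_realC /=; congr (_ +i* _); field.
rewrite /su11_e /su11_f; case: ifP => _; last case: ifP => _;
  apply/matrixP => i j; rewrite !mxE; case: ifP => _; case: ifP => _;
  rewrite ?mulr0 ?mulr1 ?mulrN ?e ?e4 ?half_realC //.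
  by congr (_ +i* _); rewrite oppr0.
by congr (_ +i* _); rewrite oppr0.
Qed.

Lemma mx22M (a b c d a' b' c' d' : R[i]) : mx22 a b c d *m mx22 a' b' c' d' =
  mx22 (a * a' + b * c') (a * b' + b * d') (c * a' + d * c') (c * b' + d * d').
Proof.
by apply/matrixP => i j; rewrite !mxE !big_ord_recl big_ord0 !mxE addr0; case: i => [[|[|//]] ?]; case: j => [[|[|//]] ?].
Qed.

Lemma mx22B (a b c d a' b' c' d' : R[i]) : mx22 a b c d - mx22 a' b' c' d' =
  mx22 (a - a') (b - b') (c - c') (d - d').
Proof. by apply/matrixP => i j; rewrite !mxE; do 2!case: ifP => _. Qed.

Lemma su11_coord22 (a b c d : R[i]) k : su11_coord (mx22 a b c d) 0 k =
  if k == 0 then complex.Re (b + c) else if k == 1 then complex.Im (b - c)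
  else 4 * complex.Im a.
Proof.
rewrite !mxE; case: ifP => _ //; last case: ifP => _ //.
  by rewrite /=; case: (b - c) => x y /=; ring.
by rewrite /=; case: a => x y /=; ring.
Qed.

Lemma su11_coordK (v : 'rV[R]_3) :
  su11_coord (\sum_k (v 0 k)%:C *: su11_e k) = v.
Proof.
have -> : \sum_k (v 0 k)%:C *: su11_e k =
  mx22 (0 +i* (v 0 (1+1) / 4)) ((v 0 0 / 2) +i* (v 0 1 / 2))
       ((v 0 0 / 2) +i* - (v 0 1 / 2)) (0 +i* - (v 0 (1+1) / 4)).
  rewrite sum_ord3 !su11_eE /=; apply/matrixP => i j; rewrite !mxE.
  by case: ifP => _; case: ifP => _; simpc; congr (_ +i* _); ring.
by apply/rowP; elim/ord3_ind; rewrite su11_coord22 /=; field.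
Qed.

Implicit Types u v w : 'rV[R]_3.

Definition dot u v : R := (u *m v^T) 0 0.

(* <[e_j, e_k], e_l> *)
Definition struct_const (j k l : 'I_3) : R :=
  su11_coord (su11_e j *m su11_e k - su11_e k *m su11_e j) 0 l.

Lemma struct_constE j k l : struct_const j k l =
  (if (j == 0) && (k == 1) && (l == 1+1) then -2 else
   if (j == 1) && (k == 0) && (l == 1+1) then 2 else
   if (j == 0) && (k == 1+1) && (l == 1) then - 2^-1 else
   if (j == 1+1) && (k == 0) && (l == 1) then 2^-1 else
   if (j == 1) && (k == 1+1) && (l == 0) then 2^-1 else
   if (j == 1+1) && (k == 1) && (l == 0) then - 2^-1 else 0).
Proof.
rewrite /struct_const.
move: j k l; elim/ord3_ind; elim/ord3_ind => l; rewrite !su11_eE /= !mx22M.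
all: rewrite mx22B su11_coord22.
all: move: l; elim/ord3_ind; rewrite /=; by field.
Qed.

Lemma struct_constC j k l : struct_const j k l = - struct_const k j l.
Proof.
by rewrite !struct_constE; move: j k l; elim/ord3_ind; elim/ord3_ind; elim/ord3_ind; rewrite /=; lra.
Qed.

(* <nabla_(e_j) e_k, e_l>, by the Koszul formula *)
Definition christoffel (j k l : 'I_3) : R :=
  2^-1 * (struct_const j k l - struct_const k l j + struct_const l j k).

(* By the next three lemmas christoffel describes the only left-invariant
   connection that is metric and torsion free. *)
Lemma christoffel_metric j k l : christoffel j k l = - christoffel j l k.
Proof.
rewrite /christoffel (struct_constC j l k) (struct_constC l k j).
by rewrite (struct_constC k j l); lra.
Qed.

Lemma christoffel_torsion_free j k l :
  christoffel j k l - christoffel k j l = struct_const j k l.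
Proof.
rewrite /christoffel (struct_constC k j l) (struct_constC j l k).
by rewrite (struct_constC l k j); lra.
Qed.

Lemma christoffel_unique (D : 'I_3 -> 'I_3 -> 'I_3 -> R) :
  (forall j k l, D j k l = - D j l k) ->
  (forall j k l, D j k l - D k j l = struct_const j k l) ->
  forall j k l, D j k l = christoffel j k l.
Proof.
move=> Dm Dt j k l; rewrite /christoffel -!Dt.
by rewrite (Dm l j k) (Dm k l j) (Dm j l k); lra.
Qed.

Definition bracket u v : 'rV[R]_3 :=
  \row_l \sum_j \sum_k u 0 j * v 0 k * struct_const j k l.

Definition nabla u v : 'rV[R]_3 :=
  \row_l \sum_j \sum_k u 0 j * v 0 k * christoffel j k l.

Definition curvature u v w : 'rV[R]_3 :=
  nabla u (nabla v w) - nabla v (nabla u w) - nabla (bracket u v) w.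

Definition sectional u v : R :=
  dot (curvature u v v) u / (dot u u * dot v v - dot u v ^+ 2).

(* Conjugation by the Cayley matrix maps SL(2, R) onto SU(1,1). *)
Definition cayley : 'M[C]_2 := mx22 1 (- 'i) 1 'i.

Lemma mx22E (X : 'M[R]_2) : X = mx22 (X 0 0) (X 0 1) (X 1 0) (X 1 1).
Proof.
apply/matrixP => i j; rewrite mxE.
by case: i => [[|[|//]] ?]; case: j => [[|[|//]] ?] /=; congr (X _ _); apply/val_inj.
Qed.

Lemma sl2_su11 (X : 'M[R]_2) : \tr X = 0 ->
  let Y := cayley *m map_mx (real_complex R) X *m invmx cayley in
  Y = \sum_k (su11_coord Y 0 k)%:C *: su11_e k.
Proof.
have h : cayley *m mx22 (2^-1)%:C (2^-1)%:C (0 +i* 2^-1) (0 +i* - 2^-1) = 1%:M.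
  rewrite mx22M; apply/matrixP => i j; rewrite !mxE.
  by case: i => [[|[|//]] ?]; case: j => [[|[|//]] ?] /=; simpc; congr (_ +i* _); field.
have [u _] := mulmx1_unit h.
have Vc : invmx cayley = mx22 (2^-1)%:C (2^-1)%:C (0 +i* 2^-1) (0 +i* - 2^-1).
  by rewrite -[RHS](mulKmx u) h mulmx1.
move=> tr0; have {}tr0 : X 1 1 = - X 0 0.
  apply/eqP; rewrite -addr_eq0 addrC -tr0 /mxtrace !big_ord_recl big_ord0 addr0.
  by apply/eqP; congr (_ + X _ _); apply/val_inj.
pose p := (X 0 0); pose q := (X 0 1 + X 1 0) / 2; pose t := (X 0 1 - X 1 0) / 2.
have E : cayley *m map_mx (real_complex R) X *m invmx cayley =
   \sum_k ((\row_k (if k == 0 then 2 * p else if k == 1 then - 2 * q else 4 * t)) 0 k)%:C *: su11_e k.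
  rewrite Vc [X]mx22E tr0 -/p sum_ord3 !mxE /=.
  have -> : map_mx (real_complex R) (mx22 p (X 0 1) (X 1 0) (- p)) =
     mx22 p%:C (X 0 1)%:C (X 1 0)%:C (- p)%:C.
    by apply/matrixP => i j; rewrite !mxE; do 2!case: ifP => _.
  rewrite !mx22M !su11_eE; apply/matrixP => i j; rewrite !mxE /q /t.
  case: ifP => _; case: ifP => _ /=; simpc; congr (_ +i* _); by field.
by rewrite /= {1}E E su11_coordK.
Qed.

(* coordinates in (e_1, e_2, e_3) of A^-1 B, for A in SL(2, R) and B tangent
   to SL(2, R) at A *)
Definition left_translate (A B : 'M[R]_2) : 'rV[R]_3 :=
  su11_coord (cayley *m map_mx (real_complex R) (invmx A *m B)
              *m invmx cayley).

End LieAlgebra.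

Record chart (R : realType) (M : topologicalType) := Chart {
  dom : set M;
  coord : M -> R * R;
  icoord : R * R -> M;
  dom_open : open dom;
  img_open : open (coord @` dom);
  coord_homeo : homeo_on dom (coord @` dom) coord;
  coordK : {in dom, cancel coord icoord}
}.

Definition img (R : realType) (M : topologicalType) (c : chart R M)
  : set (R * R) := coord c @` dom c.

Definition compatible (R : realType) (M : topologicalType) (c d : chart R M)
    : Prop :=
  let O := coord c @` (dom c `&` dom d) in
  let t := coord d \o icoord c in
  [/\ smooth O (fst \o t), smooth O (snd \o t) &
      forall p, O p -> 0 < jacobian t p].

Record closed_oriented_surface (R : realType) := ClosedOrientedSurface {
  surf :> ptopologicalType;
  surf_compact : compact [set: surf];
  surf_hausdorff : hausdorff_space surf;
  atlas : set (chart R surf);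
  atlas_cover : forall p, exists2 c, atlas c & dom c p;
  atlas_compatible : forall c d, atlas c -> atlas d -> compatible c d;
  atlas_maximal : forall c,
    (forall d, atlas d -> compatible c d /\ compatible d c) -> atlas c
}.

Section Surface.
Variables (R : realType) (G : universal_cover_SL2 R).
Variables (M : closed_oriented_surface R) (f : M -> G).
Local Notation C := R[i].
Implicit Types (c : chart R M) (p : R * R) (H Khat : M -> R).

Definition in_chart c p : 'M[R]_2 := uproj (f (icoord c p)).

(* the coordinates of f^-1 f_x and f^-1 f_y *)
Definition fx c p : 'rV[R]_3 := left_translate (in_chart c p)
  (\matrix_(i, j) dx (fun q => in_chart c q i j) p).
Definition fy c p : 'rV[R]_3 := left_translate (in_chart c p)
  (\matrix_(i, j) dy (fun q => in_chart c q i j) p).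

(* Since uproj is a local diffeomorphism, a continuous f is smooth if and only
   if uproj \o f is. *)
Definition immersion : Prop :=
  continuous f /\
  forall c, atlas c ->
    (forall i j, smooth (img c) (fun p => in_chart c p i j)) /\
    (forall p, img c p -> row_free (col_mx (fx c p) (fy c p))).

Definition conformal_parameter c : Prop :=
  atlas c /\
  forall p, img c p ->
    dot (fx c p) (fx c p) = dot (fy c p) (fy c p) /\
    dot (fx c p) (fy c p) = 0.

(* e^(2 alpha), in a conformal parameter *)
Definition e2alpha c p : R := dot (fx c p) (fx c p).

Definition Zcoef c (k : 'I_3) p : C :=
  2^-1 * ((fx c p 0 k)%:C - 'i * (fy c p 0 k)%:C).

(* coefficient of e_k in f^-1(N); k + 1 and k + 2 are taken modulo 3 *)
Definition normal c (k : 'I_3) p : C :=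
  2 * 'i * ((e2alpha c p)^-1)%:C *
  ((Zcoef c (k + 1) p)^* * Zcoef c (k + 2) p - Zcoef c (k + 1) p * (Zcoef c (k + 2) p)^*).

(* coefficient of e_k in f^-1(nabla_(f_zbar) f_z) *)
Definition nabla_zbar_z c (k : 'I_3) p : C :=
  dzbar (Zcoef c k) p +
  \sum_j \sum_l (Zcoef c j p)^* * Zcoef c l p * (christoffel R j l k)%:C.

Definition mean_curvature H : Prop :=
  forall c p, conformal_parameter c -> img c p -> forall k,
    nabla_zbar_z c k p =
    2^-1 * (e2alpha c p)%:C * (H (icoord c p))%:C * normal c k p.

Definition tangent_sectional_curvature Khat : Prop :=
  forall c p, atlas c -> img c p ->
    Khat (icoord c p) = sectional (fx c p) (fy c p).

Definition borel := g_sigma_algebraType (@open M).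

Definition area_measure (mu : set borel -> \bar R) : Prop :=
  forall c, conformal_parameter c ->
  forall B : set borel, measurable B -> B `<=` dom c ->
    mu B = (\int[@area2 R]_(p in coord c @` B) (e2alpha c p)%:E)%E.

Definition generating_spinor c (psi1 psi2 : R * R -> C) : Prop :=
  [/\ smoothC (img c) psi1, smoothC (img c) psi2 &
      forall p, img c p ->
      [/\ Zcoef c 0 p = 'i / 2 * ((psi2 p)^* ^+ 2 + psi1 p ^+ 2),
          Zcoef c 1 p = 2^-1 * ((psi2 p)^* ^+ 2 - psi1 p ^+ 2) &
          Zcoef c 2 p = psi1 p * (psi2 p)^*]].

Definition potentialU (H : R) (psi1 psi2 : C) : C :=
  H%:C / 2 * (`|psi1| ^+ 2 + `|psi2| ^+ 2) +
  'i * (1 / 2 * `|psi1| ^+ 2 - 3 / 4 * `|psi2| ^+ 2).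

Definition potentialV (H : R) (psi1 psi2 : C) : C :=
  H%:C / 2 * (`|psi1| ^+ 2 + `|psi2| ^+ 2) +
  'i * (3 / 4 * `|psi1| ^+ 2 - 1 / 2 * `|psi2| ^+ 2).

Definition partition_of_unity n (c : 'I_n -> chart R M) (rho : 'I_n -> M -> R)
    : Prop :=
  [/\ forall i d, atlas d -> smooth (img d) (rho i \o icoord d),
      forall i q, 0 <= rho i q,
      forall i, closure [set q | rho i q != 0] `<=` dom (c i) &
      forall q, \sum_i rho i q = 1].

(* E is the integral over M of the 2-form equal to
   UV (i/2) dz /\ dzbar = UV dx /\ dy in each conformal parameter z, computed
   with some smooth partition of unity subordinate to a finite family of
   conformal parameters whose domains carry generating spinors. *)
Definition energy H (E : C) : Prop :=
  exists (n : nat) (c : 'I_n -> chart R M) (rho : 'I_n -> M -> R)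
         (psi1 psi2 : 'I_n -> R * R -> C),
    [/\ forall i, conformal_parameter (c i),
        partition_of_unity c rho,
        forall i, generating_spinor (c i) (psi1 i) (psi2 i) &
        E = \sum_i integralC (img (c i)) (fun p =>
              (rho i (icoord (c i) p))%:C *
              (potentialU (H (icoord (c i) p)) (psi1 i p) (psi2 i p) *
               potentialV (H (icoord (c i) p)) (psi1 i p) (psi2 i p)))].

End Surface.

(* Main.v *)
(* Pointwise, in a conformal parameter, the identities e^(2 alpha) =
   (|psi1|^2 + |psi2|^2)^2, n_3 := <f_x x f_y, e_3> = |psi2|^4 - |psi1|^4 and
   Khat = 1 - 5 n_3^2 / e^(4 alpha) show that Re (UV) dx dy is the integrand of
   the right-hand side, while Im (UV) = - 5/8 H n_3.  It remains to see that
   the integral of H <N, e_3> over M vanishes.  As e_3 is a Killing field, the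
   e_3-component of the mean curvature equation says that
   2 H n_3 = d_x <f_x, e_3> + d_y <f_y, e_3>: this is the divergence of the
   tangential part of e_3.  Integrating by parts against a partition of unity
   (rho_i) in the charts leaves minus the sum over i of the integrals of
   <grad rho_i, e_3>; these pairings do not depend on the conformal parameter
   and add up to <grad 1, e_3> = 0.  No change of variables in the plane is
   needed to glue the charts, because the area measure mu is already known in
   each of them. *)

(* The obstacle is analytic. [H] and [Khat] are bare functions, tied to [f] only by equations in the
   charts, while integrals are total functions that are additive only on integrable arguments; so
   regularity has to be recovered before any sum is exchanged with an integral. Pairing the
   curvature equation with the normal solves it for [H], which is thereby continuous in every
   conformal parameter, and the closed form of [Khat] makes it continuous as well. Each integrand
   cut off by some rho_i is then continuous with compact support in one chart. All calculus takes
   place on the real matrix [uproj (f q)] rather than in the covering group. Its determinant is 1,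
   so its inverse is its adjugate and left translation is polynomial in the entries. The constant 5
   is a difference of ambient curvatures: planes containing e_3 have sectional curvature 1, the
   horizontal plane has -4. *)
Require Import Defs.
From HB Require Import structures.
From mathcomp Require Import all_boot all_order all_algebra.
From mathcomp Require Import complex.
From mathcomp Require Import all_classical all_reals all_analysis.
From mathcomp Require Import measure measurable_realfun lebesgue_measure.
From mathcomp Require Import ring lra.
Import Order.TTheory GRing.Theory Num.Theory numFieldNormedType.Exports.

Set Implicit Arguments.
Unset Strict Implicit.
Unset Printing Implicit Defensive.

Local Open Scope classical_set_scope.
Local Open Scope ring_scope.
Local Open Scope complex_scope.

(** * Pointwise algebra *)

Section PointwiseAlgebra.
Variable R : realType.
Implicit Types (A B : 'M[R]_2) (u v w : 'rV[R]_3).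

Lemma invmx_det1 A : \det A = 1 ->
  invmx A = mx22 (A 1 1) (- A 0 1) (- A 1 0) (A 0 0).
Proof.
move=> A1; rewrite /invmx unitmxE A1 unitr1 invr1 scale1r.
apply/matrixP => i j; rewrite !mxE /cofactor det_mx11 !mxE.
case: i => [[|[|//]] ?]; case: j => [[|[|//]] ?] /=;
  rewrite ?expr0 ?expr1 ?sqrrN ?expr1n ?mul1r ?mulN1r;
  (congr (- A _ _) || congr (A _ _) || (rewrite /exprz expr2 mulrNN !mul1r; congr (A _ _))); exact/val_inj.
Qed.

(** [left_translate] with the inverse replaced by the adjugate and the Cayley conjugation carried
    out. Being free of division, it is visibly C^1 in its entries and linear in [B]. *)
Definition left_translate_poly A B (k : 'I_3) : R :=
  if k == 0 then A 1 1 * B 0 0 - A 0 1 * B 1 0 + A 1 0 * B 0 1 - A 0 0 * B 1 1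
  else if k == 1 then
    A 0 1 * B 1 1 - A 1 1 * B 0 1 + A 1 0 * B 0 0 - A 0 0 * B 1 0
  else 2 * (A 1 1 * B 0 1 - A 0 1 * B 1 1 + A 1 0 * B 0 0 - A 0 0 * B 1 0).

Lemma invmx_cayley : invmx (cayley R) =
  mx22 (2^-1)%:C (2^-1)%:C (0 +i* 2^-1) (0 +i* - 2^-1).
Proof.
have h : cayley R *m mx22 (2^-1)%:C (2^-1)%:C (0 +i* 2^-1) (0 +i* - 2^-1) = 1%:M.
  rewrite mx22M; apply/matrixP => i j; rewrite !mxE.
  case: i => [[|[|//]] ?]; case: j => [[|[|//]] ?] /=; simpc;
  by congr (_ +i* _); field.
have [u _] := mulmx1_unit h.
by rewrite -[RHS](mulKmx u) h mulmx1.
Qed.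

Lemma map_mx22 (a b c d : R) : map_mx (real_complex R) (mx22 a b c d) =
  mx22 a%:C b%:C c%:C d%:C.
Proof. by apply/matrixP => i j; rewrite !mxE; do 2!case: ifP => _. Qed.

Lemma mx22M_real (a b c d a' b' c' d' : R) :
  mx22 a b c d *m mx22 a' b' c' d' =
  mx22 (a * a' + b * c') (a * b' + b * d') (c * a' + d * c') (c * b' + d * d').
Proof.
by apply/matrixP => i j; rewrite !mxE !big_ord_recl big_ord0 !mxE addr0; case: i => [[|[|//]] ?]; case: j => [[|[|//]] ?].
Qed.

Lemma left_translateE A B k : \det A = 1 ->
  left_translate A B 0 k = left_translate_poly A B k.
Proof.
move=> A1; rewrite /left_translate (invmx_det1 A1) invmx_cayley.
rewrite [in LHS](mx22E B) mx22M_real map_mx22 !mx22M su11_coord22.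
rewrite /left_translate_poly; case: ifP => _; last case: ifP => _.
all: by simpc; rewrite /=; field.
Qed.

Lemma christoffelE (j k l : 'I_3) : christoffel R j k l =
  (if (j == 0) && (k == 1) && (l == 1+1) then -1 else
   if (j == 1) && (k == 0) && (l == 1+1) then 1 else
   if (j == 0) && (k == 1+1) && (l == 1) then 1 else
   if (j == 1+1) && (k == 0) && (l == 1) then 3 / 2 else
   if (j == 1) && (k == 1+1) && (l == 0) then -1 else
   if (j == 1+1) && (k == 1) && (l == 0) then - (3 / 2) else 0).
Proof.
rewrite /christoffel !struct_constE.
by move: j k l; elim/ord3_ind; elim/ord3_ind; elim/ord3_ind; rewrite /=; field.
Qed.

Lemma nablaE u v l : nabla u v 0 l =
  if l == 0 then - (u 0 1 * v 0 (1+1)) - 3 / 2 * (u 0 (1+1) * v 0 1)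
  else if l == 1 then u 0 0 * v 0 (1+1) + 3 / 2 * (u 0 (1+1) * v 0 0)
  else u 0 1 * v 0 0 - u 0 0 * v 0 1.
Proof.
rewrite mxE sum_ord33; move: l; elim/ord3_ind; rewrite !christoffelE /=; by field.
Qed.

Lemma bracketE u v l : bracket u v 0 l =
  if l == 0 then 2^-1 * (u 0 1 * v 0 (1+1) - u 0 (1+1) * v 0 1)
  else if l == 1 then - 2^-1 * (u 0 0 * v 0 (1+1) - u 0 (1+1) * v 0 0)
  else - 2 * (u 0 0 * v 0 1 - u 0 1 * v 0 0).
Proof.
rewrite mxE sum_ord33; move: l; elim/ord3_ind; rewrite !struct_constE /=; by field.
Qed.

Lemma dotE u v : dot u v = u 0 0 * v 0 0 + u 0 1 * v 0 1 + u 0 (1+1) * v 0 (1+1).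
Proof. by rewrite /dot mxE sum_ord3 !mxE. Qed.

(** Left undivided, the numerator of the sectional curvature is a polynomial identity in the six
    coordinates, valid for all [u] and [v]. *)
Lemma sectional_num u v : dot (curvature u v v) u =
  dot u u * dot v v - dot u v ^+ 2 - 5 * (u 0 0 * v 0 1 - u 0 1 * v 0 0) ^+ 2.
Proof.
have subE (a b : 'rV[R]_3) l : (a - b) 0 l = a 0 l - b 0 l by rewrite !mxE.
by rewrite !dotE /curvature !subE !nablaE !bracketE /=; field.
Qed.

(** The cyclic indices are those of [normal], so this is the normal vector before division by e^(2
    alpha). *)
Definition cross u v : 'rV[R]_3 :=
  \row_k (u 0 (k + 1) * v 0 (k + 2) - u 0 (k + 2) * v 0 (k + 1)).

(** A nested [prod] instead of a conjunction, so that [rewrite] takes it as one multirule. *)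
Lemma ord3_succ : prod (0 + 1 = 1 :> 'I_3) (prod (0 + 2 = 1 + 1 :> 'I_3)
  (prod (1 + 2 = 0 :> 'I_3) (prod (1 + 1 + 1 = 0 :> 'I_3) (1 + 1 + 2 = 1 :> 'I_3)))).
Proof. by do !split; exact/val_inj. Qed.

Lemma crossE u v k : cross u v 0 k =
  if k == 0 then u 0 1 * v 0 (1+1) - u 0 (1+1) * v 0 1
  else if k == 1 then u 0 (1+1) * v 0 0 - u 0 0 * v 0 (1+1)
  else u 0 0 * v 0 1 - u 0 1 * v 0 0.
Proof. by rewrite mxE; move: k; elim/ord3_ind; rewrite /= !ord3_succ. Qed.

Lemma dot_cross u v : dot u u = dot v v -> dot u v = 0 ->
  dot (cross u v) (cross u v) = dot u u ^+ 2.
Proof.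
move=> uv uv0; rewrite expr2 {2}uv.
(* Lagrange's identity for the cross product. *)
transitivity (dot u u * dot v v - dot u v * dot u v); last by rewrite uv0 mul0r subr0.
by rewrite !dotE !crossE /=; ring.
Qed.

Lemma sectional_conformal u v : dot u u = dot v v -> dot u v = 0 -> dot u u != 0 ->
  sectional u v = 1 - 5 * cross u v 0 (1+1) ^+ 2 / dot u u ^+ 2.
Proof.
move=> uv uv0 u0; rewrite /sectional sectional_num -uv uv0 crossE /=.
by field.
Qed.

Lemma sqr_normcE (z : R[i]) :
  `|z| ^+ 2 = (complex.Re z ^+ 2 + complex.Im z ^+ 2)%:C.
Proof. by case: z => a b; rewrite sqr_normc /=; simpc; congr (_ +i* _); ring. Qed.

Lemma potentialUE (h : R) (p q : R[i]) (a b : R) :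
    `|p| ^+ 2 = a%:C -> `|q| ^+ 2 = b%:C ->
  potentialU h p q = (h / 2 * (a + b)) +i* (1 / 2 * a - 3 / 4 * b).
Proof.
move=> pa qb; rewrite /potentialU pa qb.
have -> : (3 / 4 : R[i]) = (3 / 4)%:C by rewrite rmorphM fmorphV !rmorph_nat.
by rewrite div1r half_realC; simpc; congr (_ +i* _); field.
Qed.

Lemma potentialVE (h : R) (p q : R[i]) (a b : R) :
    `|p| ^+ 2 = a%:C -> `|q| ^+ 2 = b%:C ->
  potentialV h p q = (h / 2 * (a + b)) +i* (3 / 4 * a - 1 / 2 * b).
Proof.
move=> pa qb; rewrite /potentialV pa qb.
have -> : (3 / 4 : R[i]) = (3 / 4)%:C by rewrite rmorphM fmorphV !rmorph_nat.
by rewrite div1r half_realC; simpc; congr (_ +i* _); field.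
Qed.

(** With a = |p|^2 and b = |q|^2, the product (a/2 - 3b/4)(3a/4 - b/2) of the imaginary parts of the
    potentials equals (25 (a - b)^2 - (a + b)^2)/64. The constants of the theorem are read off from
    25/64 = 1/4 * 5/16 * 5 and 1/64 = 1/4 * (5/16 - 1/4). *)
Lemma energy_density (h : R) u v (p q : R[i]) :
    dot u u = dot v v -> dot u v = 0 -> dot u u != 0 ->
    let Z k : R[i] := 2^-1 * ((u 0 k)%:C - 'i * (v 0 k)%:C) in
    Z 0 = 'i / 2 * (q^* ^+ 2 + p ^+ 2) -> Z 1 = 2^-1 * (q^* ^+ 2 - p ^+ 2) ->
    Z (1+1) = p * q^* ->
  potentialU h p q * potentialV h p q =
    (4^-1 * (h ^+ 2 + 5 / 16 * sectional u v - 4^-1) * dot u u) +i*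
    (- (5 / 8) * h * cross u v 0 (1+1)).
Proof.
move=> uv uv0 u0 Z.
have ZE k : Z k = (u 0 k / 2) +i* (- (v 0 k / 2)).
  by rewrite /Z half_realC; simpc; congr (_ +i* _); field.
have i2 : ('i / 2 : R[i]) = 0 +i* 2^-1.
  by rewrite half_realC; simpc; congr (_ +i* _); field.
rewrite !ZE (potentialUE h (sqr_normcE p) (sqr_normcE q)).
rewrite (potentialVE h (sqr_normcE p) (sqr_normcE q)).
rewrite sectional_conformal // {Z ZE uv uv0}; move: u0.
rewrite dotE crossE i2 half_realC /=; case: p q => [a b] [c d].
rewrite [(a +i* b) ^+ 2]expr2 [(_ ^+ 2 : R[i])]expr2; simpc => u0.
(* Each complex equation splits into a real and an imaginary part. Since Z_k = (u_k - i v_k)/2, the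
   factors 2 and -2 turn them into formulas for u_k and v_k. *)
case=> /(congr1 ( *%R 2)) + /(congr1 ( *%R (- 2))).
have H2 (z : R) : 2 * (z / 2) = z by field.
have H2' (z : R) : - 2 * - (z / 2) = z by field.
rewrite H2 H2' => x0 y0.
case=> /(congr1 ( *%R 2)) + /(congr1 ( *%R (- 2))); rewrite H2 H2' => x1 y1.
case=> /(congr1 ( *%R 2)) + /(congr1 ( *%R (- 2))); rewrite H2 H2' => x2 y2.
have e2 : u 0 0 * u 0 0 + u 0 1 * u 0 1 + u 0 (1 + 1) * u 0 (1 + 1) =
    (a ^+ 2 + b ^+ 2 + (c ^+ 2 + d ^+ 2)) ^+ 2.
  by rewrite x0 x1 x2; field.
have n2 : u 0 0 * v 0 1 - u 0 1 * v 0 0 = 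
    (c ^+ 2 + d ^+ 2) ^+ 2 - (a ^+ 2 + b ^+ 2) ^+ 2.
  by rewrite x0 x1 y0 y1; field.
(* The metric is the square of a + b, so its positivity supplies the nonzero denominator that
   [field] needs. *)
move: u0; rewrite e2 n2 expf_eq0 /= => u0.
by simpc; congr (_ +i* _); field.
Qed.

End PointwiseAlgebra.

(** * Calculus and integration in the plane *)

Section Calculus2.
Variable R : realType.
Implicit Types (f g : R * R -> R) (O : set (R * R)) (p q : R * R).

Definition C1 O g : Prop :=
  [/\ forall p, O p -> {for p, continuous g},
      forall p, O p -> derivable g p ((1, 0) : R * R)
                       /\ derivable g p ((0, 1) : R * R),
      forall p, O p -> {for p, continuous (dx g)} &
      forall p, O p -> {for p, continuous (dy g)}].

Lemma smooth_C1 O g : smooth O g -> C1 O g.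
Proof. by move=> /(_ 1%N) [gc [gd [gx _] [gy _]]]; exact: And4 gc gd gx gy. Qed.

Lemma smooth_dx O g : smooth O g -> smooth O (dx g).
Proof. by move=> sg k; have [_ []] := sg k.+1. Qed.

Lemma smooth_dy O g : smooth O g -> smooth O (dy g).
Proof. by move=> sg k; have [_ []] := sg k.+1. Qed.

Lemma eq_continuous_on O f g : open O -> (forall p, O p -> f p = g p) ->
  (forall p, O p -> {for p, continuous f}) ->
  forall p, O p -> {for p, continuous g}.
Proof.
move=> oO fg fc p Op; change (g @ p --> g p); rewrite -(fg p) //.
have near_fg : {near p, f =1 g}.
  near=> q; apply: fg; near: q; exact: open_nbhs_nbhs.
exact: cvg_trans (near_eq_cvg near_fg) (fc p Op).
Unshelve. all: by end_near. Qed.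

Lemma eq_C1 O f g : open O -> (forall p, O p -> f p = g p) -> C1 O f -> C1 O g.
Proof.
move=> oO fg [fc fd fx fy].
have near_fg p : O p -> {near p, f =1 g}.
  by move=> Op; near=> q; apply: fg; near: q; exact: open_nbhs_nbhs.
have dE v p : O p -> 'D_v f p = 'D_v g p.
  by move=> Op; apply: near_eq_derive; exact: near_fg.
split=> [|p Op||].
- exact: eq_continuous_on fc.
- have [? ?] := fd _ Op; split; exact: near_eq_derivable (near_fg _ Op) _.
- by apply: eq_continuous_on fx => // q Oq; exact: dE.
- by apply: eq_continuous_on fy => // q Oq; exact: dE.
Unshelve. all: by end_near. Qed.

Lemma C1_cst O a : C1 O (cst a).
Proof.
have [dx0 dy0] : dx (cst a) = cst 0 /\ dy (cst a) = cst 0.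
  by split; apply/funext => p; exact: derive_cst.
split=> p Op; first exact: cst_continuous.
- by split; exact: derivable_cst.
- by rewrite dx0; exact: cst_continuous.
- by rewrite dy0; exact: cst_continuous.
Qed.

Lemma dxD f g p : derivable f p ((1, 0) : R * R) -> derivable g p ((1, 0) : R * R) ->
  dx (fun q => f q + g q) p = dx f p + dx g p.
Proof. exact: deriveD. Qed.

Lemma dyD f g p : derivable f p ((0, 1) : R * R) -> derivable g p ((0, 1) : R * R) ->
  dy (fun q => f q + g q) p = dy f p + dy g p.
Proof. exact: deriveD. Qed.

Lemma dxM f g p : derivable f p ((1, 0) : R * R) -> derivable g p ((1, 0) : R * R) ->
  dx (fun q => f q * g q) p = f p * dx g p + g p * dx f p.
Proof. exact: deriveM. Qed.

Lemma dyM f g p : derivable f p ((0, 1) : R * R) -> derivable g p ((0, 1) : R * R) ->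
  dy (fun q => f q * g q) p = f p * dy g p + g p * dy f p.
Proof. exact: deriveM. Qed.

Lemma C1D O f g : open O -> C1 O f -> C1 O g -> C1 O (fun q => f q + g q).
Proof.
move=> oO [fc fd fx fy] [gc gd gx gy]; split=> [p Op|p Op||].
- by apply: continuousD; [exact: fc|exact: gc].
- have [f1 f2] := fd _ Op; have [g1 g2] := gd _ Op.
  exact: conj (derivableD f1 g1) (derivableD f2 g2).
- apply: (@eq_continuous_on O (fun q => dx f q + dx g q)) => // p Op.
    have [f1 _] := fd _ Op; have [g1 _] := gd _ Op; exact/esym/dxD.
  by apply: continuousD; [exact: fx|exact: gx].
- apply: (@eq_continuous_on O (fun q => dy f q + dy g q)) => // p Op.
    have [_ f1] := fd _ Op; have [_ g1] := gd _ Op; exact/esym/dyD.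
  by apply: continuousD; [exact: fy|exact: gy].
Qed.

Lemma C1M O f g : open O -> C1 O f -> C1 O g -> C1 O (fun q => f q * g q).
Proof.
move=> oO [fc fd fx fy] [gc gd gx gy]; split=> [p Op|p Op||].
- by apply: continuousM; [exact: fc|exact: gc].
- have [f1 f2] := fd _ Op; have [g1 g2] := gd _ Op.
  exact: conj (derivableM f1 g1) (derivableM f2 g2).
- apply: (@eq_continuous_on O (fun q => f q * dx g q + g q * dx f q)) => // p Op.
    have [f1 _] := fd _ Op; have [g1 _] := gd _ Op; exact/esym/dxM.
  by apply: continuousD; apply: continuousM; [exact: fc|exact: gx|exact: gc|exact: fx].
- apply: (@eq_continuous_on O (fun q => f q * dy g q + g q * dy f q)) => // p Op.
    have [_ f1] := fd _ Op; have [_ g1] := gd _ Op; exact/esym/dyM.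
  by apply: continuousD; apply: continuousM; [exact: fc|exact: gy|exact: gc|exact: fy].
Qed.

(** The two difference quotients are the same function of the increment. This opens the way to
    one-variable results: the mean value theorem and the fundamental theorem of calculus. *)
Lemma slice_x g a y : derivable g (a, y) ((1, 0) : R * R) ->
  is_derive a 1 (fun s => g (s, y)) (dx g (a, y)).
Proof.
move=> dg.
have E : (fun h : R => h^-1 *: ((g \o shift (a, y)) (h *: ((1, 0) : R * R)) - g (a, y))) =
   (fun h : R => h^-1 *: (((fun s => g (s, y)) \o shift a) (h *: (1 : R)) - g (a, y))).
  apply/funext => h /=; congr (_ *: (g _ - _)); congr (_, _) => /=.
  by rewrite scaler0 add0r.
by split; rewrite /derivable /dx /derive -E.
Qed.

Lemma slice_y g x b : derivable g (x, b) ((0, 1) : R * R) ->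
  is_derive b 1 (fun s => g (x, s)) (dy g (x, b)).
Proof.
move=> dg.
have E : (fun h : R => h^-1 *: ((g \o shift (x, b)) (h *: ((0, 1) : R * R)) - g (x, b))) =
   (fun h : R => h^-1 *: (((fun s => g (x, s)) \o shift b) (h *: (1 : R)) - g (x, b))).
  apply/funext => h /=; congr (_ *: (g _ - _)); congr (_, _) => /=.
  by rewrite scaler0 add0r.
by split; rewrite /derivable /dy /derive -E.
Qed.


(** The condition by absolute values treats increments of either sign at once and matches the square
    neighbourhoods of the plane. *)
Lemma mvt_is_derive (h dh : R -> R) (a b : R) :
    (forall s, `|s - a| <= `|b - a| -> is_derive s 1 h (dh s)) ->
  exists2 c, `|c - a| <= `|b - a| & h b - h a = dh c * (b - a).
Proof.
have cont (u v : R) : (forall s, u <= s <= v -> is_derive s 1 h (dh s)) ->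
    {within `[u, v], continuous h}.
  move=> hd; apply: continuous_in_subspaceT => s; rewrite inE /= in_itv /= => uv.
  by apply/differentiable_continuous/derivable1_diffP; have [] := hd s uv.
have [ab|ba] := leP a b => hd.
- have H s : a <= s <= b -> is_derive s 1 h (dh s).
    by move=> /andP[as_ sb]; apply: hd; rewrite !ger0_norm ?subr_ge0 // lerB.
  have [||c] := @MVT_segment _ h dh a b ab.
  + by move=> s; rewrite in_itv /= => /andP[/ltW as_ /ltW sb]; apply: H; rewrite as_.
  + exact: cont.
  + rewrite in_itv /= => /andP[ac cb] E; exists c => //.
    by rewrite !ger0_norm ?subr_ge0 // lerB.
- have H s : b <= s <= a -> is_derive s 1 h (dh s).
    move=> /andP[bs sa]; apply: hd; rewrite !ler0_norm ?subr_le0 ?(ltW ba) //.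
    by rewrite lerN2 lerB.
  have [||c] := @MVT_segment _ h dh b a (ltW ba).
  + by move=> s; rewrite in_itv /= => /andP[/ltW as_ /ltW sb]; apply: H; rewrite as_.
  + exact: cont.
  + rewrite in_itv /= => /andP[bc ca] E; exists c.
      by rewrite !ler0_norm ?subr_le0 ?(ltW ba) // lerN2 lerB.
    by rewrite -opprB E -mulrN opprB.
Qed.

Lemma differentiable_of_littleo (V W : normedModType R) (h : V -> W)
    (L : {linear V -> W}) (x : V) : continuous L ->
  (forall e, 0 < e -> exists2 d : R, 0 < d &
    forall v, `|v| < d -> `|h (v + x) - h x - L v| <= e * `|v|) ->
  differentiable h x.
Proof.
move=> Lc Lo; have hL : h \o shift x = cst (h x) + L +o_ 0 id.
  apply/eqaddoP => e e0; have [d d0 Hd] := Lo e e0.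
  near=> v; rewrite !fctE opprD addrA; apply: Hd; near: v; exact: nbhs0_lt.
by apply/diff_locallyP; rewrite (diff_unique Lc hL).
Unshelve. all: by end_near.
Qed.

(** The increment is split into a horizontal step at height [h2 + p2] and a vertical step over [p1].
    The mean value theorem replaces each by a partial derivative at a nearby point, which differs
    from its value at the base point by less than e/2. *)
Lemma C1_taylor O g (p1 p2 e : R) : open O -> C1 O g -> O (p1, p2) -> 0 < e ->
  exists2 d : R, 0 < d & forall h1 h2, `|h1| < d -> `|h2| < d ->
    `|g (h1 + p1, h2 + p2) - g (p1, p2)
      - (h1 * dx g (p1, p2) + h2 * dy g (p1, p2))| <= e * Num.max `|h1| `|h2|.
Proof.
move=> oO [gc gd gx gy] Op e0.
have e2 : 0 < e / 2 by rewrite divr_gt0.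
have nO : \forall q \near (p1, p2), O q by exact: (open_nbhs_nbhs (conj oO Op)).
have nx : \forall q \near (p1, p2), `|dx g (p1, p2) - dx g q| < e / 2.
  by have /cvgrPdist_lt/(_ _ e2) := gx _ Op.
have ny : \forall q \near (p1, p2), `|dy g (p1, p2) - dy g q| < e / 2.
  by have /cvgrPdist_lt/(_ _ e2) := gy _ Op.
have : \forall q \near (p1, p2), O q /\
    (`|dx g (p1, p2) - dx g q| < e / 2 /\ `|dy g (p1, p2) - dy g q| < e / 2).
  exact: filterI nO (filterI nx ny).
move=> /nbhs_ballP[d /= d0 pd].
exists d => // h1 h2 h1d h2d.
have H a b : `|a - p1| <= `|h1| -> `|b - p2| <= `|h2| ->
  [/\ O (a, b), `|dx g (p1, p2) - dx g (a, b)| < e / 2 &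
    `|dy g (p1, p2) - dy g (a, b)| < e / 2].
  move=> ap bp; have [|? [? ?]] := pd (a, b); last by split.
  split; rewrite /ball /= distrC.
    exact: le_lt_trans ap h1d.
  exact: le_lt_trans bp h2d.
have h2p : `|h2 + p2 - p2| <= `|h2| by rewrite addrK.
have p1p : `|p1 - p1| <= `|h1| by rewrite subrr normr0.
have [c|c] := @mvt_is_derive (fun s => g (s, h2 + p2))
    (fun s => dx g (s, h2 + p2)) p1 (h1 + p1).
  rewrite addrK => cp; apply: slice_x; have [Oc _ _] := H c (h2 + p2) cp h2p.
  exact: (gd _ Oc).1.
rewrite !addrK => cp Ex.
have [c'|c'] := @mvt_is_derive (fun s => g (p1, s))
    (fun s => dy g (p1, s)) p2 (h2 + p2).
  rewrite addrK => cp'; apply: slice_y; have [Oc _ _] := H p1 c' p1p cp'.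
  exact: (gd _ Oc).2.
rewrite !addrK => cp' Ey.
have -> : g (h1 + p1, h2 + p2) - g (p1, p2) -
    (h1 * dx g (p1, p2) + h2 * dy g (p1, p2)) =
   (dx g (c, h2 + p2) - dx g (p1, p2)) * h1 +
   (dy g (p1, c') - dy g (p1, p2)) * h2.
  by rewrite !mulrBl -Ex -Ey; ring.
have [_ /ltW Hx _] := H c (h2 + p2) cp h2p.
have [_ _ /ltW Hy] := H p1 c' p1p cp'.
rewrite (le_trans (ler_normD _ _)) // !normrM [e]splitr mulrDl.
by apply: lerD; apply: ler_pM; rewrite ?normr_ge0 1?distrC // le_max lexx ?orbT.
Qed.

(** The existence of partial derivatives does not give a chain rule. The passage to the total
    derivative is made so that transition maps can be composed in [dx_comp]. *)
Lemma C1_differentiable O g p : open O -> C1 O g -> O p -> differentiable g p.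
Proof.
case: p => p1 p2 oO C1g Op.
pose L (v : R * R) : R := v.1 * dx g (p1, p2) + v.2 * dy g (p1, p2).
have linL : linear L.
  by move=> k u v; rewrite /L /= /GRing.scale /=; ring.
have Lc : continuous L.
  move=> v; apply: (@continuousD _ _ _ (fun v : R * R => v.1 * _) (fun v : R * R => v.2 * _)).
    by apply: continuousM; [exact: cvg_fst|exact: cvg_cst].
  by apply: continuousM; [exact: cvg_snd|exact: cvg_cst].
pose LM := GRing.isLinear.Build _ _ _ _ _ linL.
pose LL : {linear _ -> _} := HB.pack L LM.
apply: (@differentiable_of_littleo _ _ g LL _ Lc) => e e0.
have [d d0 Hd] := C1_taylor oO C1g Op e0; exists d => // -[h1 h2].
rewrite prod_normE /= gt_max => /andP[h1d h2d]; exact: Hd.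
Qed.

Lemma dx_comp O g (t : R * R -> R * R) (U : set (R * R)) p :
    open O -> C1 O g -> open U -> C1 U (fst \o t) -> C1 U (snd \o t) ->
    U p -> O (t p) ->
  dx (g \o t) p = dx g (t p) * dx (fst \o t) p + dy g (t p) * dx (snd \o t) p /\
  dy (g \o t) p = dx g (t p) * dy (fst \o t) p + dy g (t p) * dy (snd \o t) p.
Proof.
move=> oO C1g oU t1 t2 Up Otp.
have dg := C1_differentiable oO C1g Otp.
have d1 := C1_differentiable oU t1 Up.
have d2 := C1_differentiable oU t2 Up.
have tE : t = (fun q => ((fst \o t) q, (snd \o t) q)).
  by apply/funext => q /=; case: (t q).
have dt : differentiable t p by rewrite tE; exact: differentiable_pair.
have dgt := differentiable_comp dt dg.
have gE (v : R * R) : 'd g (t p) v = v.1 * dx g (t p) + v.2 * dy g (t p).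
  rewrite /dx /dy !deriveE // -linearZ -[_ * 'd g _ _]linearZ -linearD; congr ('d g _ _).
  have E : (v.1, v.2) = (v.1 * 1 + v.2 * 0, v.1 * 0 + v.2 * 1).
    by rewrite !mulr1 !mulr0 addr0 add0r.
  by case: v E => v1 v2; exact: id.
have dtE v : 'd t p v = ('d (fst \o t) p v, 'd (snd \o t) p v).
  by rewrite {1}tE diff_pair.
have key v : 'D_v (g \o t) p =
    dx g (t p) * 'D_v (fst \o t) p + dy g (t p) * 'D_v (snd \o t) p.
  rewrite (deriveE v dgt) (diff_comp dt dg).
  change ('d g (t p) ('d t p v) = dx g (t p) * 'D_v (fst \o t) p + dy g (t p) * 'D_v (snd \o t) p).
  rewrite dtE gE (deriveE v d1) (deriveE v d2); congr (_ + _); exact: mulrC.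
exact: conj (key _) (key _).
Qed.

End Calculus2.

(** * Integration against a measure given by a density in a parameter *)

Section Transfer.
Context d1 d2 (T1 : measurableType d1) (T2 : measurableType d2) (R : realType).
Variables (mu : {measure set T1 -> \bar R}) (nu : {measure set T2 -> \bar R}).
Variables (D : set T1) (O : set T2) (phi : T2 -> T1) (w : T2 -> R).
Hypotheses (mD : measurable D) (mO : measurable O) (mphi : measurable_fun O phi).
Hypotheses (phiD : forall x, O x -> D (phi x)) (mw : measurable_fun O w).
Hypothesis w0 : forall x, O x -> 0 <= w x.
Hypothesis muE : forall B, measurable B -> B `<=` D ->
  mu B = (\int[nu]_(x in O `&` phi @^-1` B) (w x)%:E)%E.

Import HBNNSimple.
Local Open Scope ereal_scope.

(** [muE] is the case of indicator functions; simple functions follow by linearity and nonnegative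
    ones by monotone convergence on both sides. *)
Lemma ge0_integral_density (h : T1 -> \bar R) : measurable_fun D h ->
  (forall x, D x -> 0 <= h x) ->
  \int[mu]_(x in D) h x = \int[nu]_(x in O) (h (phi x) * (w x)%:E).
Proof.
move=> mh h0; pose g := nnsfun_approx mD mh.
have mgphi n : measurable_fun O (g n \o phi).
  by apply: (measurable_comp measurableT) => //; exact/measurable_funP.
have -> : \int[mu]_(x in D) h x =
    lim (\int[mu]_(x in D) (EFin \o g n) x @[n --> \oo]).
  have fE x : D x -> h x = lim ((EFin \o g n) x @[n --> \oo]).
    by move=> Dx; apply/esym/cvg_lim => //; exact: cvg_nnsfun_approx.
  under eq_integral => x /[!inE] /fE -> //.
  apply: monotone_convergence => //.
  - move=> n; apply/measurable_EFinP.
    by apply: (measurable_funS measurableT) => //; exact/measurable_funP.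
  - by move=> n x Ex //=; rewrite lee_fin.
  - by move=> x Ex a b ab; rewrite lee_fin; exact/lefP/nd_nnsfun_approx.
have -> : \int[nu]_(x in O) (h (phi x) * (w x)%:E) =
    lim (\int[nu]_(x in O) ((g n (phi x))%:E * (w x)%:E) @[n --> \oo]).
  have fE x : O x -> h (phi x) * (w x)%:E =
      lim ((fun n => (g n (phi x))%:E * (w x)%:E) n @[n --> \oo]).
    move=> Ox; apply/esym/cvg_lim => //; apply: cvgeZr => //.
    exact: (cvg_nnsfun_approx mD mh h0 (phiD Ox)).
  under eq_integral => x /[!inE] /fE -> //.
  apply: monotone_convergence => //.
  - by move=> n; apply/emeasurable_funM; apply/measurable_EFinP; [exact: mgphi|].
  - by move=> n x Ox /=; rewrite mule_ge0 ?lee_fin ?w0.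
  - move=> x Ox a b ab /=; rewrite lee_wpmul2r ?lee_fin ?w0//.
    exact/lefP/nd_nnsfun_approx.
(* It remains to compare the integrals of one simple function, expanded as a finite sum of its
   values times indicators. *)
congr (limn _); apply/funext => n.
have mpre r : measurable (g n @^-1` [set r]) by exact: measurable_sfunP.
have indich r : measurable_fun D (fun x => (r * \1_(g n @^-1` [set r]) x)%:E).
  by apply: (measurable_comp measurableT) => //; exact: measurable_funM.
transitivity (\int[mu]_(x in D)
   (\sum_(y \in range (g n)) (y * \1_(g n @^-1` [set y]) x)%:E)).
  by apply: eq_integral => t tE; rewrite /= fimfunE -fsumEFin.
rewrite ge0_integral_fsum//; last by move=> m y Ey; exact: nnfun_muleindic_ge0.
transitivity (\int[nu]_(x in O) (\sum_(y \in range (g n))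
    (y * \1_(g n @^-1` [set y]) (phi x))%:E * (w x)%:E)); last first.
  apply: eq_integral => x xE.
  rewrite -ge0_mule_fsuml => [|y]; last exact: nnfun_muleindic_ge0.
  by rewrite fsumEFin // -(fimfunE _ (phi x)).
have mi r : measurable_fun O (fun x => (r * \1_(g n @^-1` [set r]) (phi x))%:E).
  apply/measurable_EFinP; apply: measurable_funM => //.
  by apply: (measurable_comp measurableT).
rewrite ge0_integral_fsum//; last 2 first.
  - by move=> y; apply: emeasurable_funM => //; exact/measurable_EFinP.
  - by move=> r x Ox; rewrite mule_ge0 ?lee_fin ?w0 // -lee_fin EFinM nnfun_muleindic_ge0.
apply: eq_fsbigr => r; rewrite inE => -[t _ <-]; set r' := g n t.
have r0 : (0 <= r')%R by [].
under eq_integral do rewrite EFinM.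
rewrite integralZl_indic_nnsfun //.
under [RHS]eq_integral do rewrite EFinM -muleA.
rewrite ge0_integralZl//; last 2 first.
- apply: emeasurable_funM; apply/measurable_EFinP => //.
  by apply: (measurable_comp measurableT).
- by move=> x Ox; rewrite mule_ge0 ?lee_fin ?w0.
congr (_ * _); rewrite integral_indic // muE; last 2 first.
- exact: measurableI.
- exact: subIsetr.
have -> : O `&` phi @^-1` (g n @^-1` [set r'] `&` D) =
    O `&` phi @^-1` (g n @^-1` [set r']).
  by apply/seteqP; split=> x /= [Ox]; [case|split=> //; split=> //; exact: phiD].
rewrite integral_mkcondr; apply: eq_integral => x _.
rewrite patchE indicE.
have -> : (x \in phi @^-1` (g n @^-1` [set r'])) =
    (phi x \in g n @^-1` [set r']) by apply/idP/idP; rewrite !inE.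
by case: ifP => _; rewrite ?mul1e ?mul0e.
Qed.

(** As [w] is nonnegative, multiplication by it commutes with taking positive and negative parts. *)
Lemma integral_density (h : T1 -> \bar R) : measurable_fun D h ->
  \int[mu]_(x in D) h x = \int[nu]_(x in O) (h (phi x) * (w x)%:E).
Proof.
move=> mh; rewrite integralE ge0_integral_density; last 2 first.
- exact: measurable_funepos.
- by move=> x _; exact: funepos_ge0.
rewrite ge0_integral_density; last 2 first.
- exact: measurable_funeneg.
- by move=> x _; exact: funeneg_ge0.
rewrite [RHS]integralE; congr (_ - _); apply: eq_integral => x /[!inE] Ox.
  by rewrite !funeposE maxe_pMl ?lee_fin ?w0 // mul0e.
by rewrite !funenegE maxe_pMl ?lee_fin ?w0 // mul0e mulNe.
Qed.

Lemma integrable_density (h : T1 -> \bar R) : measurable_fun D h ->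
  nu.-integrable O (fun x => h (phi x) * (w x)%:E) -> mu.-integrable D h.
Proof.
move=> mh /integrableP[_ hw]; apply/integrableP; split => //.
rewrite ge0_integral_density; [|exact: measurableT_comp|by []].
rewrite (le_lt_trans _ hw) // le_eqVlt; apply/orP; left; apply/eqP.
apply: eq_integral => x /[!inE] Ox.
by rewrite abseM [`|(w x)%:E|]gee0_abs // lee_fin w0.
Qed.

End Transfer.

(** * Measurability and integrability in the plane *)

Section PlaneMeasure.
Variable R : realType.
Local Notation R2 := (measurableTypeR R * measurableTypeR R)%type.
Implicit Types (O K : set (R * R)) (f g : R * R -> R).

(** The plane carries the product sigma-algebra, generated by rectangles and not by open sets;
    second countability is used to pass from one to the other. *)
Lemma open_plane_measurable O : open O -> measurable (O : set R2).
Proof.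
move=> oO; pose rect (r : (rat * rat) * (rat * rat)) : set (R * R) :=
  `]ratr r.1.1, ratr r.1.2[ `*` `]ratr r.2.1, ratr r.2.2[.
(* The union runs over all rational rectangles, with the empty set for those not inside [O], so that
   the index type is countable. *)
have -> : O = \bigcup_r (if `[< rect r `<=` O >] then rect r else set0).
  apply/seteqP; split=> [[x y] Oxy|p [r _]]; last first.
    by case: ifPn => // /asboolP; exact.
  have /nbhs_ballP[d /= d0 dO] : nbhs (x, y) O by exact: open_nbhs_nbhs.
  have rat_near (z : R) : exists a b : rat,
      [/\ z - d < ratr a, ratr a < z, z < ratr b & ratr b < z + d].
    have [a] : exists a, ratr a \in `]z - d, z[ by apply: rat_in_itvoo; lra.
    have [b] : exists b, ratr b \in `]z, z + d[ by apply: rat_in_itvoo; lra.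
    by rewrite !in_itv /= => /andP[? ?] /andP[? ?]; exists a, b.
  have [a [b [a1 a2 b1 b2]]] := rat_near x.
  have [a' [b' [a1' a2' b1' b2']]] := rat_near y.
  exists ((a, b), (a', b')) => //; rewrite ifT.
    by split; rewrite /= in_itv /= ?a2 ?a2'.
  apply/asboolP => -[u v] [/=]; rewrite !in_itv /= => /andP[u1 u2] /andP[v1 v2].
  by apply: dO; split; rewrite /ball /= ltr_norml; lra.
apply: countable_bigcupT_measurable; first exact: countableP.
move=> r; case: ifP => // _.
by apply: measurableX; exact: measurable_itv.
Qed.

Lemma compact_plane_measurable K : compact K -> measurable (K : set R2).
Proof.
move=> cK; rewrite -(setCK K); apply: measurableC; apply: open_plane_measurable.
by rewrite openC; apply: compact_closed => //; exact: norm_hausdorff.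
Qed.

Lemma measurable_fun_open d (T : measurableType d) (D : set T) (h : T -> R) :
  measurable D -> (forall B, open B -> measurable (D `&` h @^-1` B)) ->
  measurable_fun D h.
Proof.
move=> mD hB; apply: (measurability _ (RGenOInfty.measurableE R)) => //.
by move=> _ [_ [x ->] <-]; apply: hB.
Qed.

Lemma continuous_plane_measurable O f : open O ->
  (forall p, O p -> {for p, continuous f}) ->
  measurable_fun (O : set R2) (f : R2 -> R).
Proof.
move=> oO fc; apply: measurable_fun_open; first exact: open_plane_measurable.
move=> B oB; apply: open_plane_measurable.
rewrite openE => p [Op Bp]; apply: filterI; first exact: open_nbhs_nbhs.
by apply: (fc p Op); exact: open_nbhs_nbhs.
Qed.

Lemma compact_box K : compact K ->
  exists2 b : R, 0 < b & forall p, K p -> `|p.1| < b /\ `|p.2| < b.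
Proof.
move=> /compact_bounded[M [_ HM]]; exists (`|M| + 1); first by rewrite ltr_wpDl.
move=> p Kp; have : `|p| <= `|M| + 1 / 2 by apply: HM => //; rewrite ltr_pwDr // ler_norm.
rewrite prod_normE ge_max => /andP[p1 p2].
by split; [apply: le_lt_trans p1 _|apply: le_lt_trans p2 _]; rewrite ltrD2l; lra.
Qed.

Lemma compact_plane_finite K : compact K -> (@area2 R K < +oo)%E.
Proof.
move=> cK; have [b b0 Kb] := compact_box cK.
have sub : K `<=` `[- b, b]%classic `*` `[- b, b]%classic.
  move=> p /Kb[/ltW + /ltW]; rewrite !ler_norml => p1 p2.
  by split; rewrite /= in_itv.
apply: (@le_lt_trans _ _ (@area2 R (`[- b, b]%classic `*` `[- b, b]%classic))).
  apply: le_measure => //; rewrite inE.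
    exact: compact_plane_measurable.
  by apply: measurableX; exact: measurable_itv.
have -> : @area2 R (`[- b, b]%classic `*` `[- b, b]%classic) =
    ((@lebesgue_measure R `[(- b)%R, b]%classic) * (@lebesgue_measure R `[(- b)%R, b]%classic))%E.
  by apply: product_measure1E; exact: measurable_itv.
by rewrite lebesgue_measure_itv /=; case: ifP => _; rewrite -?EFinB -?EFinM ?mule0 ?ltry.
Qed.

Lemma integrable_compact_support K f : compact K -> continuous f ->
  (forall p, ~ K p -> f p = 0) ->
  (@area2 R).-integrable setT (EFin \o (f : R2 -> R)).
Proof.
move=> cK fc f0.
have mK := compact_plane_measurable cK.
have fE : f = f \_ K.
  apply/funext => p; rewrite patchE; case: ifPn => // /negP pK.
  by apply: f0 => Kp; apply: pK; rewrite inE.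
have mf : measurable_fun (setT : set R2) (f : R2 -> R).
  by apply: (@continuous_plane_measurable setT f openT) => p _; exact: fc.
rewrite fE -restrict_EFin; apply/integrable_restrict => //; rewrite ?setTI //.
apply: measurable_bounded_integrable => //.
- exact: compact_plane_finite.
- exact: measurable_funS mf.
have /compact_bounded[M [Mr HM]] : compact (f @` K).
  by apply: continuous_compact => //; exact: continuous_subspaceT.
exists M; split => // y My p Kp; apply: (HM y My); by exists p.
Qed.

End PlaneMeasure.

(** * Derivatives of compactly supported functions integrate to zero *)

Section Stokes.
Variable R : realType.
Local Notation R2 := (measurableTypeR R * measurableTypeR R)%type.
Implicit Types (O K W : set (R * R)) (f g : R * R -> R).

Lemma integral_derivative0 (h dh : R -> R) (b : R) : 0 < b ->
    (forall s : R, is_derive s 1 h (dh s)) -> continuous dh ->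
    (forall s, b <= `|s| -> h s = 0) -> (forall s, b <= `|s| -> dh s = 0) ->
  (\int[@lebesgue_measure R]_s (dh s)%:E = 0)%E.
Proof.
move=> b0 hd dhc h0 dh0.
have hc : continuous h.
  by move=> s; apply/differentiable_continuous/derivable1_diffP; have [] := hd s.
have -> : (fun s => (dh s)%:E) = (fun s => (dh s)%:E) \_ `[- b, b].
  apply/funext => s; rewrite patchE; case: ifPn => // /negP sb.
  congr (_%:E); apply: dh0; rewrite leNgt; apply/negP => /ltW; rewrite ler_norml => sb'.
  by apply: sb; rewrite inE /= in_itv.
rewrite -integral_mkcond (@continuous_FTC2 _ dh h).
- by rewrite (h0 b) ?(h0 (- b)) ?subee // ?normrN ger0_norm // ltW.
- by rewrite gtrN.
- exact: continuous_subspaceT.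
- split.
  + by move=> s _; have [] := hd s.
  + exact: cvg_at_right_filter (hc _).
  + exact: cvg_at_left_filter (hc _).
- by move=> s _; rewrite derive1E; have [] := hd s.
Qed.

Lemma compact_plane_open K : compact K -> open (~` K).
Proof.
by move=> cK; rewrite openC; apply: compact_closed => //; exact: norm_hausdorff.
Qed.

Lemma open_support_dx_dy W g p : open W -> (forall q, W q -> g q = 0) -> W p ->
  dx g p = 0 /\ dy g p = 0.
Proof.
move=> oW g0 Wp; have near0 : {near p, cst (0 : R) =1 g}.
  near=> q; apply/esym/g0; near: q; exact: (open_nbhs_nbhs (conj oW Wp)).
by split; rewrite -[LHS](near_eq_derive _ near0) derive_cst.
Unshelve. all: by end_near. Qed.

(** By Fubini one may integrate first along the direction of differentiation, where the fundamental
    theorem of calculus gives 0 on every line. *)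
Lemma integral_dx_dy0 K f : compact K -> C1 setT f -> (forall p, ~ K p -> f p = 0) ->
  (\int[@area2 R]_p (dx f p)%:E = 0)%E /\ (\int[@area2 R]_p (dy f p)%:E = 0)%E.
Proof.
move=> cK [fc fd fx fy] f0; have [b b0 Kb] := compact_box cK.
have out p : b <= `|p.1| \/ b <= `|p.2| -> [/\ f p = 0, dx f p = 0 & dy f p = 0].
  move=> bp; have Kp : ~ K p by move=> /Kb[]; case: bp; rewrite leNgt => /negP.
  by have [? ?] := open_support_dx_dy (compact_plane_open cK) f0 Kp; rewrite f0.
have pc1 y : continuous (fun s : R => (s, y) : R * R).
  move=> s; have sy : cst y @ s --> y by exact: cvg_cst.
  exact: cvg_pair (@cvg_id _ (nbhs s)) sy.
have pc2 x : continuous (fun s : R => (x, s) : R * R).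
  move=> s; have sx : cst x @ s --> x by exact: cvg_cst.
  exact: cvg_pair sx (@cvg_id _ (nbhs s)).
split.
- have ix : (@area2 R).-integrable setT (EFin \o (dx f : R2 -> R)).
    apply: (integrable_compact_support cK) => [p|p Kp]; first exact: fx.
    exact: (open_support_dx_dy (compact_plane_open cK) f0 Kp).1.
  rewrite -(integral21_prod_meas1 ix); apply: integral0_eq => y _.
  apply: (@integral_derivative0 (fun s => f (s, y)) (fun s => dx f (s, y)) b b0).
  + by move=> s; apply: slice_x; exact: (fd _ I).1.
  + move=> s; exact: (continuous_comp (pc1 y s) (fx (s, y) I)).
  + by move=> s bs; have [] := out (s, y) (or_introl bs).
  + by move=> s bs; have [] := out (s, y) (or_introl bs).
- have iy : (@area2 R).-integrable setT (EFin \o (dy f : R2 -> R)).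
    apply: (integrable_compact_support cK) => [p|p Kp]; first exact: fy.
    exact: (open_support_dx_dy (compact_plane_open cK) f0 Kp).2.
  rewrite -(integral12_prod_meas1 iy); apply: integral0_eq => x _.
  apply: (@integral_derivative0 (fun s => f (x, s)) (fun s => dy f (x, s)) b b0).
  + by move=> s; apply: slice_y; exact: (fd _ I).2.
  + move=> s; exact: (continuous_comp (pc2 x s) (fy (x, s) I)).
  + by move=> s bs; have [] := out (x, s) (or_intror bs).
  + by move=> s bs; have [] := out (x, s) (or_intror bs).
Qed.

(** The open sets [O] and the complement of [K] cover the plane; the extension by zero is [f] on the
    first and 0 on the second. The next lemma glues derivatives over the same cover. *)
Lemma restrict_continuous O K f : open O -> compact K -> K `<=` O ->
    (forall p, O p -> {for p, continuous f}) ->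
    (forall p, O p -> ~ K p -> f p = 0) -> continuous (f \_ O).
Proof.
move=> oO cK KO fc f0 p; have [Op|Op] := pselect (O p).
  apply: (@eq_continuous_on _ O f (f \_ O)) => // q Oq.
  by rewrite patchE ifT // inE.
apply: (@eq_continuous_on _ (~` K) (cst 0) (f \_ O)).
- exact: compact_plane_open.
- move=> q Kq; rewrite patchE; case: ifPn => // /[!inE] Oq.
  by rewrite f0.
- by move=> q _; exact: cst_continuous.
- by move=> Kp; apply/Op/KO.
Qed.

Lemma restrict_C1 O K f : open O -> compact K -> K `<=` O -> C1 O f ->
    (forall p, O p -> ~ K p -> f p = 0) -> C1 setT (f \_ O).
Proof.
move=> oO cK KO C1f f0.
have C1O : C1 O (f \_ O).
  by apply: eq_C1 C1f => // q Oq; rewrite patchE ifT // inE.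
have C1K : C1 (~` K) (f \_ O).
  apply: (@eq_C1 _ _ (cst 0)); [exact: compact_plane_open| |exact: C1_cst].
  by move=> q Kq; rewrite patchE; case: ifPn => // /[!inE] Oq; rewrite f0.
have OK p : O p \/ (~` K) p.
  by have [Op|Op] := pselect (O p); [left|right => /KO].
case: C1O C1K => [a b c d] [a' b' c' d'].
have OR (P : R * R -> Prop) : (forall p, O p -> P p) ->
    (forall p, (~` K) p -> P p) -> forall p, setT p -> P p.
  by move=> PO PK p _; case: (OK p); [exact: PO|exact: PK].
exact: And4 (OR _ a a') (OR _ b b') (OR _ c c') (OR _ d d').
Qed.

Lemma integrable_open_compact O K f : open O -> compact K -> K `<=` O ->
    (forall p, O p -> {for p, continuous f}) ->
    (forall p, O p -> ~ K p -> f p = 0) ->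
  (@area2 R).-integrable (O : set R2) (EFin \o (f : R2 -> R)).
Proof.
move=> oO cK KO fc f0.
have mO := open_plane_measurable oO.
apply/(integrable_mkcond _ mO).
rewrite restrict_EFin; apply: (integrable_compact_support cK).
  exact: restrict_continuous fc f0.
by move=> p Kp; rewrite patchE; case: ifPn => // /[!inE] Op; rewrite f0.
Qed.

Lemma Rintegral_dx_dy0 O K f : open O -> compact K -> K `<=` O -> C1 O f ->
    (forall p, O p -> ~ K p -> f p = 0) ->
  \int[@area2 R]_(p in O) dx f p = 0 /\ \int[@area2 R]_(p in O) dy f p = 0.
Proof.
move=> oO cK KO C1f f0.
have f0' p : ~ K p -> (f \_ O) p = 0.
  by move=> Kp; rewrite patchE; case: ifPn => // /[!inE] Op; rewrite f0.
have [ix iy] := integral_dx_dy0 cK (restrict_C1 oO cK KO C1f f0) f0'.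
have near_f p : O p -> {near p, f =1 f \_ O}.
  move=> Op; near=> q; rewrite patchE ifT // inE; near: q.
  exact: (open_nbhs_nbhs (conj oO Op)).
(* Off [O] both sides vanish: the left one by restriction, the right one because such points lie
   outside [K]. *)
have dxE : (dx f) \_ O = dx (f \_ O).
  apply/funext => p; rewrite patchE; case: ifPn => [/[!inE] Op|/negP Op].
    exact: near_eq_derive (near_f p Op).
  by rewrite (open_support_dx_dy (compact_plane_open cK) f0' _).1 // => /KO Op'; apply: Op; rewrite inE.
have dyE : (dy f) \_ O = dy (f \_ O).
  apply/funext => p; rewrite patchE; case: ifPn => [/[!inE] Op|/negP Op].
    exact: near_eq_derive (near_f p Op).
  by rewrite (open_support_dx_dy (compact_plane_open cK) f0' _).2 // => /KO Op'; apply: Op; rewrite inE.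
split; (apply: etrans; first exact: Rintegral_mkcond).
  by rewrite dxE /Rintegral ix.
by rewrite dyE /Rintegral iy.
Unshelve. all: by end_near. Qed.

End Stokes.

(** * Charts, frames and curvature *)

Local Notation coord := Defs.coord.

Section ChartTopology.
Variables (R : realType) (M : topologicalType).
Implicit Types (c d : chart R M) (p : R * R).

Lemma open_img c : open (img c).
Proof. exact: img_open. Qed.

Lemma icoord_dom c p : img c p -> dom c (icoord c p).
Proof. by move=> [q Dq <-]; rewrite coordK // inE. Qed.

Lemma icoordK c p : img c p -> coord c (icoord c p) = p.
Proof. by move=> [q Dq <-]; rewrite coordK // inE. Qed.

Lemma domK c q : dom c q -> icoord c (coord c q) = q.
Proof. by move=> Dq; rewrite coordK // inE. Qed.

Lemma coord_img c q : dom c q -> img c (coord c q).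
Proof. by move=> Dq; exists q. Qed.

(** Brings the domain of integration in [area_measure] into the form of the hypothesis [muE] of the
    transfer lemmas. *)
Lemma img_preimageE c (B : set M) : B `<=` dom c ->
  coord c @` B = img c `&` icoord c @^-1` B.
Proof.
move=> Bc; apply/seteqP; split=> [_ [q Bq <-]|p [ip Bp]].
  by split=> /=; [exact/coord_img/Bc|rewrite domK //; exact: Bc].
by exists (icoord c p) => //; exact: icoordK.
Qed.

Lemma icoord_open c (W : set M) : open W -> open (img c `&` icoord c @^-1` W).
Proof.
move=> oW; have [_ _ hW] := coord_homeo c; have [U oU E] := hW W oW.
have -> : img c `&` icoord c @^-1` W = img c `&` U.
  rewrite -[RHS]E; apply/seteqP; split=> [p [ip Wp]|_ [q [Dq Wq] <-]].
    by exists (icoord c p); [split=> //; exact: icoord_dom|exact: icoordK].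
  by split=> /=; [exact: coord_img|rewrite domK].
by apply: openI => //; exact: img_open.
Qed.

Lemma coord_open c (O : set (R * R)) : open O -> open (dom c `&` coord c @^-1` O).
Proof.
move=> oO; have [cc _ _] := coord_homeo c.
rewrite (continuous_open_subspace _ (dom_open c)) in cc.
rewrite openE => q [Dq Oq]; apply: filterI.
  exact: (open_nbhs_nbhs (conj (dom_open c) Dq)).
by apply: (cc q); [rewrite inE|exact: (open_nbhs_nbhs (conj oO Oq))].
Qed.

Lemma coord_compact c (K : set M) : compact K -> K `<=` dom c ->
  compact (coord c @` K).
Proof.
move=> cK Kc; have [cc _ _] := coord_homeo c.
exact: continuous_compact (continuous_subspaceW Kc cc) cK.
Qed.

Lemma overlap_open c d : open (coord c @` (dom c `&` dom d)).
Proof.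
rewrite img_preimageE; last exact: subIsetl.
exact/icoord_open/openI/dom_open/dom_open.
Qed.

End ChartTopology.
Arguments open_img {R M} c.

Section SmoothFrame.
Variable R : realType.
Implicit Types (O : set (R * R)) (a b : 'I_2 -> 'I_2 -> R * R -> R).

Lemma C1Z O (g : R * R -> R) (k : R) : open O -> C1 O g -> C1 O (fun q => k * g q).
Proof. by move=> oO; apply: C1M => //; exact: C1_cst. Qed.

Lemma C1N O (g : R * R -> R) : open O -> C1 O g -> C1 O (fun q => - g q).
Proof.
move=> oO C1g; apply: eq_C1 (C1Z (-1) oO C1g) => // p _.
by rewrite mulN1r.
Qed.

Lemma C1_left_translate O a b k : open O ->
    (forall i j, C1 O (a i j)) -> (forall i j, C1 O (b i j)) ->
  C1 O (fun p => left_translate_poly (\matrix_(i, j) a i j p) (\matrix_(i, j) b i j p) k).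
Proof.
move=> oO C1a C1b; have C1ab i j i' j' := C1M oO (C1a i j) (C1b i' j').
move: k; elim/ord3_ind; rewrite /left_translate_poly /=.
- apply: (@eq_C1 _ _ (fun p => a 1 1 p * b 0 0 p + - (a 0 1 p * b 1 0 p) + a 1 0 p * b 0 1 p + - (a 0 0 p * b 1 1 p))) => //.
    by move=> p _; rewrite !mxE.
  by do ?apply: (C1D oO); do ?apply: (C1N oO); exact: C1ab.
- apply: (@eq_C1 _ _ (fun p => a 0 1 p * b 1 1 p + - (a 1 1 p * b 0 1 p) + a 1 0 p * b 0 0 p + - (a 0 0 p * b 1 0 p))) => //.
    by move=> p _; rewrite !mxE.
  by do ?apply: (C1D oO); do ?apply: (C1N oO); exact: C1ab.
- apply: (@eq_C1 _ _ (fun p => 2 * (a 1 1 p * b 0 1 p + - (a 0 1 p * b 1 1 p) + a 1 0 p * b 0 0 p + - (a 0 0 p * b 1 0 p)))) => //.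
    by move=> p _; rewrite !mxE.
  by apply: (C1Z _ oO); do ?apply: (C1D oO); do ?apply: (C1N oO); exact: C1ab.
Qed.

End SmoothFrame.

(** The bracket is w - w^* for a complex number w, hence purely imaginary. Multiplication by 2i
    makes it real, so the components of [normal] are real. *)
Lemma cross_complex (R : realType) (x y x' y' e : R) :
  2 * 'i * (e^-1)%:C *
    (((x / 2) +i* (- (y / 2)))^* * ((x' / 2) +i* (- (y' / 2))) -
     ((x / 2) +i* (- (y / 2))) * ((x' / 2) +i* (- (y' / 2)))^*) =
  ((x * y' - x' * y) / e)%:C.
Proof.
have -> : (2 * 'i : R[i]) = 0 +i* 2 by simpc; congr (_ +i* _); rewrite ?addr0; ring.
by move: e^-1 => E; simpc; congr (_ +i* _); field.
Qed.

Lemma ReD (R : rcfType) (a b : R[i]) :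
  complex.Re (a + b) = complex.Re a + complex.Re b.
Proof. by case: a b => ? ? []. Qed.

Lemma Re_sum (R : rcfType) (I : finType) (F : I -> R[i]) :
  complex.Re (\sum_i F i) = \sum_i complex.Re (F i).
Proof. exact: (big_morph _ (@ReD R)). Qed.

Lemma Im_sum (R : rcfType) (I : finType) (F : I -> R[i]) :
  complex.Im (\sum_i F i) = \sum_i complex.Im (F i).
Proof. by apply: (big_morph (@complex.Im R)) => // -[? ?] []. Qed.

Lemma Re_dzbar (R : realType) (h : R * R -> R[i]) p :
  complex.Re (dzbar h p) = 2^-1 * (dx (Re_ h) p - dy (Im_ h) p).
Proof.
rewrite /dzbar half_realC.
move: (dx (Re_ h) p) (dx (Im_ h) p) (dy (Re_ h) p) (dy (Im_ h) p) => a b c d.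
by simpc; rewrite /=; ring.
Qed.

Lemma Re_conj_mul (R : realType) (x y x' y' g : R) :
  complex.Re (((x / 2) +i* (- (y / 2)))^* * ((x' / 2) +i* (- (y' / 2))) * g%:C) =
  4^-1 * (x * x' * g + y * y' * g).
Proof. by simpc; rewrite /=; field. Qed.

Lemma cross_succE (R : realType) (u v : 'rV[R]_3) k :
  cross u v 0 k = u 0 (k + 1) * v 0 (k + 2) - u 0 (k + 2) * v 0 (k + 1).
Proof. by rewrite mxE. Qed.

Lemma nabla_sumE (R : realType) (u v : 'rV[R]_3) k :
  nabla u v 0 k = \sum_i \sum_j u 0 i * v 0 j * christoffel R i j k.
Proof. by rewrite mxE. Qed.

(* e_3 is a Killing field. *)
Lemma nabla_vertical (R : realType) (u : 'rV[R]_3) : nabla u u 0 (1+1) = 0.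
Proof. by rewrite nablaE /= mulrC subrr. Qed.

Lemma nabla_vertical_sum (R : realType) (a b : R) (u v : 'rV[R]_3) :
  4^-1 * (a + b + nabla u u 0 (1+1) + nabla v v 0 (1+1)) = 4^-1 * (a + b).
Proof. by rewrite !nabla_vertical !addr0. Qed.

Lemma dot_sumE (R : realType) (u v : 'rV[R]_3) : dot u v = \sum_k u 0 k * v 0 k.
Proof. by rewrite dotE sum_ord3. Qed.

(** The terms mixing [u] and [v] are purely imaginary and drop out. *)
Lemma Re_sum_christoffel (R : realType) (u v : 'rV[R]_3) k :
  complex.Re (\sum_j \sum_l ((u 0 j / 2) +i* (- (v 0 j / 2)))^* *
    ((u 0 l / 2) +i* (- (v 0 l / 2))) * (christoffel R j l k)%:C) =
  4^-1 * (nabla u u 0 k + nabla v v 0 k).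
Proof.
rewrite !nabla_sumE -big_split mulr_sumr Re_sum; apply: eq_bigr => j _.
rewrite -big_split mulr_sumr Re_sum; apply: eq_bigr => l _.
exact: Re_conj_mul.
Qed.

(** * The moving frame of the immersion and its curvature equation *)

Section SurfaceFrame.
Variables (R : realType) (G : universal_cover_SL2 R).
Variables (M : closed_oriented_surface R) (f : M -> G).
Hypothesis immf : immersion f.
Implicit Types (c d : chart R M) (p : R * R) (k : 'I_3).

Lemma det_in_chart c p : \det (in_chart f c p) = 1.
Proof.
have [_ rG _] := uproj_covering G.
have : range (@uproj R G) (in_chart f c p) by exists (f (icoord c p)).
by rewrite rG.
Qed.

Lemma fxE c p k : fx f c p 0 k = left_translate_poly (in_chart f c p)
  (\matrix_(i, j) dx (fun q => in_chart f c q i j) p) k.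
Proof. exact/left_translateE/det_in_chart. Qed.

Lemma fyE c p k : fy f c p 0 k = left_translate_poly (in_chart f c p)
  (\matrix_(i, j) dy (fun q => in_chart f c q i j) p) k.
Proof. exact/left_translateE/det_in_chart. Qed.

Lemma in_chart_C1 c i j : atlas c -> C1 (img c) (fun p => in_chart f c p i j).
Proof. by move=> Ac; apply: smooth_C1; have [_ /(_ c Ac)[]] := immf. Qed.

Lemma matrix_eta (A : 'M[R]_2) : \matrix_(i, j) A i j = A.
Proof. by apply/matrixP => i j; rewrite mxE. Qed.

Lemma fx_C1 c k : atlas c -> C1 (img c) (fun p => fx f c p 0 k).
Proof.
move=> Ac; have oc := open_img c; have [_ /(_ c Ac)[sA _]] := immf.
apply: (eq_C1 oc _ (C1_left_translate k oc (fun i j => smooth_C1 (sA i j))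
  (fun i j => smooth_C1 (smooth_dx (sA i j))))) => p _.
by rewrite matrix_eta fxE.
Qed.

Lemma fy_C1 c k : atlas c -> C1 (img c) (fun p => fy f c p 0 k).
Proof.
move=> Ac; have oc := open_img c; have [_ /(_ c Ac)[sA _]] := immf.
apply: (eq_C1 oc _ (C1_left_translate k oc (fun i j => smooth_C1 (sA i j))
  (fun i j => smooth_C1 (smooth_dy (sA i j))))) => p _.
by rewrite matrix_eta fyE.
Qed.

Lemma e2alpha_C1 c : atlas c -> C1 (img c) (e2alpha f c).
Proof.
move=> Ac; have oc := open_img c.
apply: (@eq_C1 _ _ (fun p => fx f c p 0 0 * fx f c p 0 0 +
  fx f c p 0 1 * fx f c p 0 1 + fx f c p 0 (1+1) * fx f c p 0 (1+1))) => //.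
  by move=> p _; rewrite /e2alpha dotE.
by do ?apply: (C1D oc); apply: (C1M oc); exact: fx_C1.
Qed.

Lemma e2alpha_gt0 c p : atlas c -> img c p -> 0 < e2alpha f c p.
Proof.
move=> Ac ip; have [_ /(_ c Ac)[_ /(_ p ip)]] := immf.
rewrite /e2alpha; set u := fx f c p; set v := fy f c p => free_uv.
have duE := dotE u u; have du0 : 0 <= dot u u.
  by rewrite duE !addr_ge0 // -expr2 sqr_ge0.
rewrite lt_def du0 andbT; apply/eqP => u0.
(* A zero row would leave the two-row matrix of the frame with rank at most 1, against the immersion
   hypothesis. *)
suff uz : u = 0.
  have := free_uv; rewrite uz /row_free -addsmxE adds0mx => /eqP r2.
  by have := rank_leq_row v; rewrite r2.
move: u0; rewrite duE -!expr2 => /eqP.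
rewrite paddr_eq0 ?addr_ge0 ?sqr_ge0 // paddr_eq0 ?sqr_ge0 // !sqrf_eq0.
move=> /andP[/andP[/eqP u0 /eqP u1] /eqP u2].
by apply/rowP; elim/ord3_ind; rewrite [RHS]mxE.
Qed.

Lemma conformal_atlas c : conformal_parameter f c -> atlas c.
Proof. by case. Qed.

Section Conformal.
Variables (c : chart R M) (H : M -> R) (Khat : M -> R).
Hypotheses (cc : conformal_parameter f c) (mcH : mean_curvature f H).
Hypothesis tsK : tangent_sectional_curvature f Khat.
Let Ac := conformal_atlas cc.

Let n p := cross (fx f c p) (fy f c p).

Lemma ZcoefE k p : Zcoef f c k p = (fx f c p 0 k / 2) +i* (- (fy f c p 0 k / 2)).
Proof. by rewrite /Zcoef half_realC; simpc; congr (_ +i* _); field. Qed.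

Lemma normalE k p :
  normal f c k p = (n p 0 k / e2alpha f c p)%:C.
Proof.
by rewrite /normal !ZcoefE cross_complex /n cross_succE.
Qed.

(** A quarter of the tension field, nabla_(f_x) f_x + nabla_(f_y) f_y, in the left-invariant frame.
    The real part is taken because the other side of the mean curvature equation is real. *)
Definition re_nabla k p : R :=
  4^-1 * (dx (fun q => fx f c q 0 k) p + dy (fun q => fy f c q 0 k) p +
          nabla (fx f c p) (fx f c p) 0 k + nabla (fy f c p) (fy f c p) 0 k).

Lemma Re_nabla_zbar_z k p : img c p ->
  complex.Re (nabla_zbar_z f c k p) = re_nabla k p.
Proof.
move=> ip; rewrite /nabla_zbar_z ReD.
have [_ fxd _ _] := fx_C1 k Ac; have [_ fyd _ _] := fy_C1 k Ac.
have ReZ : Re_ (Zcoef f c k) = fun q => 2^-1 * fx f c q 0 k.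
  by apply/funext => q; rewrite /Re_ ZcoefE /= mulrC.
have ImZ : Im_ (Zcoef f c k) = fun q => - 2^-1 * fy f c q 0 k.
  by apply/funext => q; rewrite /Im_ ZcoefE /= mulNr mulrC.
have dxZ : dx (Re_ (Zcoef f c k)) p = 2^-1 * dx (fun q => fx f c q 0 k) p.
  by rewrite ReZ; exact/deriveMl/(fxd p ip).1.
have dyZ : dy (Im_ (Zcoef f c k)) p = - 2^-1 * dy (fun q => fy f c q 0 k) p.
  by rewrite ImZ; exact/deriveMl/(fyd p ip).2.
have -> : complex.Re (dzbar (Zcoef f c k) p) =
    4^-1 * (dx (fun q => fx f c q 0 k) p + dy (fun q => fy f c q 0 k) p).
  rewrite Re_dzbar dxZ dyZ.
  by move: (dx _ p) (dy _ p) => a b; field.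
have -> : complex.Re (\sum_j \sum_l (Zcoef f c j p)^* * Zcoef f c l p * (christoffel R j l k)%:C) =
    4^-1 * (nabla (fx f c p) (fx f c p) 0 k + nabla (fy f c p) (fy f c p) 0 k).
  rewrite -Re_sum_christoffel; congr complex.Re.
  by apply: eq_bigr => j _; apply: eq_bigr => l _; rewrite !ZcoefE.
by rewrite /re_nabla -mulrDr !addrA.
Qed.

Lemma mean_curvature_normal k p : img c p ->
  re_nabla k p = 2^-1 * H (icoord c p) * n p 0 k.
Proof.
move=> ip; rewrite -Re_nabla_zbar_z // (mcH cc ip) normalE half_realC.
simpc; rewrite /=; field; by rewrite gt_eqF // e2alpha_gt0.
Qed.

Lemma divergence_vertical p : img c p ->
  dx (fun q => fx f c q 0 (1+1)) p + dy (fun q => fy f c q 0 (1+1)) p =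
  2 * H (icoord c p) * n p 0 (1+1).
Proof.
move=> ip; apply: (mulfI (_ : 4^-1 != 0)); first by rewrite invr_eq0.
rewrite -(nabla_vertical_sum _ _ (fx f c p) (fy f c p)).
apply: etrans (mean_curvature_normal (1+1) ip) _.
by move: (n p 0 _) => m; field.
Qed.

(** Pairing with the normal isolates [H], as the squared length of [n p] is e^(4 alpha). The
    resulting expression contains only the frame and its first derivatives. *)
Lemma mean_curvatureE p : img c p -> H (icoord c p) =
  2 * (\sum_k re_nabla k p * n p 0 k) / e2alpha f c p ^+ 2.
Proof.
move=> ip; have [_ /(_ p ip)[xy xy0]] := cc.
have e0 := e2alpha_gt0 Ac ip.
have -> : \sum_k re_nabla k p * n p 0 k = 2^-1 * H (icoord c p) * dot (n p) (n p).
  rewrite dot_sumE mulr_sumr; apply: eq_bigr => k _.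
  by rewrite (mean_curvature_normal k ip) mulrA.
have -> : dot (n p) (n p) = e2alpha f c p ^+ 2 := dot_cross xy xy0.
by move: (e2alpha f c p) e0 => e e0; field; exact: lt0r_neq0.
Qed.

Lemma Khat_chart p : img c p ->
  Khat (icoord c p) = 1 - 5 * n p 0 (1+1) ^+ 2 / e2alpha f c p ^+ 2.
Proof.
move=> ip; have [_ /(_ p ip)[xy xy0]] := cc.
rewrite (tsK Ac ip).
exact: sectional_conformal xy xy0 (lt0r_neq0 (e2alpha_gt0 Ac ip)).
Qed.

End Conformal.
End SurfaceFrame.

(** * Invariance of the pairing with e_3 under change of conformal parameter *)

Section ChangeOfChart.
Variables (R : realType).

Lemma left_translate_poly_linear (A B B' : 'M[R]_2) (a b : R) k :
  left_translate_poly A (a *: B + b *: B') k =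
  a * left_translate_poly A B k + b * left_translate_poly A B' k.
Proof. by move: k; elim/ord3_ind; rewrite /left_translate_poly /= !mxE; ring. Qed.

Lemma left_translate_poly_comb (A A' : 'M[R]_2) (e e1 e2 : 'I_2 -> 'I_2 -> R) (a b : R) k :
    A = A' -> (forall i j, e i j = a * e1 i j + b * e2 i j) ->
  left_translate_poly A (\matrix_(i, j) e i j) k =
  a * left_translate_poly A' (\matrix_(i, j) e1 i j) k +
  b * left_translate_poly A' (\matrix_(i, j) e2 i j) k.
Proof.
move=> <- eE; rewrite -left_translate_poly_linear; congr left_translate_poly.
by apply/matrixP => i j; rewrite !mxE.
Qed.

Lemma frame_change_dot (u v u' v' : 'rV[R]_3) (a b a' b' : R) :
    (forall k, u 0 k = a * u' 0 k + b * v' 0 k) ->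
    (forall k, v 0 k = a' * u' 0 k + b' * v' 0 k) ->
    dot u' u' = dot v' v' -> dot u' v' = 0 ->
  [/\ dot u u = (a ^+ 2 + b ^+ 2) * dot u' u',
      dot v v = (a' ^+ 2 + b' ^+ 2) * dot u' u' &
      dot u v = (a * a' + b * b') * dot u' u'].
Proof.
move=> uE vE uv uv0.
have dE x y x' y' (w w' : 'rV[R]_3) : (forall k, w 0 k = x * u' 0 k + y * v' 0 k) ->
    (forall k, w' 0 k = x' * u' 0 k + y' * v' 0 k) ->
    dot w w' = (x * x' + y * y') * dot u' u'.
  move=> wE wE'; have -> : dot w w' = x * x' * dot u' u' + y * y' * dot v' v' +
      (x * y' + y * x') * dot u' v' by rewrite !dotE !wE !wE'; ring.
  by rewrite -uv uv0 mulr0 addr0 mulrDl.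
by split; rewrite ?expr2; exact: dE.
Qed.

(* The rows (a, b) and (a', b') are orthogonal of equal length, hence so are
   the columns. *)
Lemma conformal_pairing (a b a' b' rx ry tx ty : R) :
    a ^+ 2 + b ^+ 2 = a' ^+ 2 + b' ^+ 2 -> a * a' + b * b' = 0 ->
    a ^+ 2 + b ^+ 2 != 0 ->
  (a * rx + b * ry) * (a * tx + b * ty) +
  (a' * rx + b' * ry) * (a' * tx + b' * ty) =
  (a ^+ 2 + b ^+ 2) * (rx * tx + ry * ty).
Proof.
move=> n o m0; set m := a ^+ 2 + b ^+ 2 in n m0 *.
(* The difference times [m] is a combination of the two hypotheses, and [m] cancels; [e3] is
   obtained in the same way. *)
have e1 : b' ^+ 2 = a ^+ 2.
  apply: (mulfI m0); apply/eqP; rewrite -subr_eq0; apply/eqP.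
  have -> : m * b' ^+ 2 - m * a ^+ 2 =
      (b * b' - a * a') * (a * a' + b * b') + a ^+ 2 * (a' ^+ 2 + b' ^+ 2 - m).
    by rewrite /m; ring.
  by rewrite o -n subrr !mulr0 addr0.
have e2 : a' ^+ 2 = b ^+ 2.
  by apply: (addIr (b' ^+ 2)); rewrite -n e1 addrC.
have e3 : a * b + a' * b' = 0.
  apply: (mulfI m0); rewrite mulr0.
  have -> : m * (a * b + a' * b') = (a * a' + b * b') * (a * b' + a' * b) +
      a * b * (m - a' ^+ 2 - b' ^+ 2).
    by rewrite /m; ring.
  by rewrite o n -addrA -opprD subrr mul0r mulr0 addr0.
have -> : (a * rx + b * ry) * (a * tx + b * ty) +
  (a' * rx + b' * ry) * (a' * tx + b' * ty) =
  (a ^+ 2 + a' ^+ 2) * (rx * tx) + (b ^+ 2 + b' ^+ 2) * (ry * ty) +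
  (a * b + a' * b') * (rx * ty + ry * tx) by ring.
by rewrite e3 e2 e1 /m; ring.
Qed.

(** Both the numerator and the metric acquire the conformal factor a^2 + b^2, which cancels in the
    quotient. *)
Lemma pairing_frame_change (u v u' v' : 'rV[R]_3) (a b a' b' rx ry : R) k :
    (forall k, u 0 k = a * u' 0 k + b * v' 0 k /\
               v 0 k = a' * u' 0 k + b' * v' 0 k) ->
    dot u u = dot v v -> dot u v = 0 -> dot u' u' = dot v' v' -> dot u' v' = 0 ->
    dot u u != 0 ->
  ((a * rx + b * ry) * u 0 k + (a' * rx + b' * ry) * v 0 k) / dot u u =
  (rx * u' 0 k + ry * v' 0 k) / dot u' u'.
Proof.
move=> uvE uv uv0 uv' uv0'; have [uE vE] := all_and2 uvE.
have [Eu Ev Euv] := frame_change_dot uE vE uv' uv0'.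
rewrite Eu mulf_eq0 negb_or => /andP[m0 e0].
have n : a ^+ 2 + b ^+ 2 = a' ^+ 2 + b' ^+ 2.
  by apply: (mulIf e0); rewrite -Ev -uv Eu.
have o : a * a' + b * b' = 0 by apply: (mulIf e0); rewrite mul0r -Euv.
by rewrite uE vE conformal_pairing // -mulf_div divff // mul1r.
Qed.

Variables (G : universal_cover_SL2 R).
Variables (M : closed_oriented_surface R) (f : M -> G).
Hypothesis immf : immersion f.
Implicit Types (c d : chart R M) (p : R * R) (k : 'I_3) (r : M -> R).

Let trans c d := coord d \o icoord c.
Let overlap c d := coord c @` (dom c `&` dom d).

Lemma overlapP c d p : overlap c d p ->
  [/\ img c p, dom d (icoord c p), img d (trans c d p) &
      icoord d (trans c d p) = icoord c p].
Proof.
move=> [q [cq dq] <-]; rewrite /trans /= domK //; split=> //; first exact: coord_img.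
  exact: coord_img.
exact: domK.
Qed.

Lemma dx_change c d (g g' : R * R -> R) p : atlas c -> atlas d ->
    C1 (img d) g' -> (forall p, overlap c d p -> g p = g' (trans c d p)) ->
    overlap c d p ->
  dx g p = dx (fst \o trans c d) p * dx g' (trans c d p) +
           dx (snd \o trans c d) p * dy g' (trans c d p) /\
  dy g p = dy (fst \o trans c d) p * dx g' (trans c d p) +
           dy (snd \o trans c d) p * dy g' (trans c d p).
Proof.
move=> Ac Ad C1g gE Op.
have oO : open (overlap c d) by exact: overlap_open.
have [s1 s2 _] := atlas_compatible Ac Ad.
have near_g : {near p, g =1 g' \o trans c d}.
  near=> q; apply: gE; near: q; exact: (open_nbhs_nbhs (conj oO Op)).
have [_ _ it _] := overlapP Op.
have [ex ey] := dx_comp (open_img d) C1g oO (smooth_C1 s1) (smooth_C1 s2) Op it.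
split; [apply: etrans (near_eq_derive _ near_g) _|apply: etrans (near_eq_derive _ near_g) _].
  by apply: etrans ex _; congr (_ + _); exact: mulrC.
by apply: etrans ey _; congr (_ + _); exact: mulrC.
Unshelve. all: by end_near. Qed.

(** The charts see the same matrix at corresponding points, and left translation is linear in the
    derivative, so the frame transforms by the chain rule applied to the entries. *)
Lemma frame_change c d p : atlas c -> atlas d -> overlap c d p -> forall k,
  fx f c p 0 k = dx (fst \o trans c d) p * fx f d (trans c d p) 0 k +
                 dx (snd \o trans c d) p * fy f d (trans c d p) 0 k /\
  fy f c p 0 k = dy (fst \o trans c d) p * fx f d (trans c d p) 0 k +
                 dy (snd \o trans c d) p * fy f d (trans c d p) 0 k.
Proof.
move=> Ac Ad Op k.
have chE q : overlap c d q -> in_chart f c q = in_chart f d (trans c d q).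
  by move=> /overlapP[_ _ _ E]; rewrite /in_chart E.
have entE i j q : overlap c d q ->
    in_chart f c q i j = in_chart f d (trans c d q) i j by move=> /chE ->.
have dE i j := dx_change Ac Ad (in_chart_C1 immf i j Ad) (entE i j) Op.
have key (uc vc ud vd : R) :
    uc = left_translate_poly (in_chart f c p)
      (\matrix_(i, j) dx (fun q => in_chart f c q i j) p) k ->
    vc = left_translate_poly (in_chart f c p)
      (\matrix_(i, j) dy (fun q => in_chart f c q i j) p) k ->
    ud = left_translate_poly (in_chart f d (trans c d p))
      (\matrix_(i, j) dx (fun q => in_chart f d q i j) (trans c d p)) k ->
    vd = left_translate_poly (in_chart f d (trans c d p))
      (\matrix_(i, j) dy (fun q => in_chart f d q i j) (trans c d p)) k ->
    uc = dx (fst \o trans c d) p * ud + dx (snd \o trans c d) p * vd /\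
    vc = dy (fst \o trans c d) p * ud + dy (snd \o trans c d) p * vd.
  move=> -> -> -> ->; split; apply: left_translate_poly_comb (chE p Op) _ => i j.
    by case: (dE i j).
  by case: (dE i j).
exact (key _ _ _ _ (@fxE R G M f c p k) (@fyE R G M f c p k)
  (@fxE R G M f d (trans c d p) k) (@fyE R G M f d (trans c d p) k)).
Qed.

(** <grad r, e_3> for the gradient in the induced metric; dividing by e^(2 alpha) raises the index
    of the differential of [r]. *)
Definition vertical_pairing c r p : R :=
  (dx (r \o icoord c) p * fx f c p 0 (1+1) +
   dy (r \o icoord c) p * fy f c p 0 (1+1)) / e2alpha f c p.

Lemma vertical_pairing_change c d r p :
    conformal_parameter f c -> conformal_parameter f d ->
    C1 (img d) (r \o icoord d) -> overlap c d p ->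
  vertical_pairing c r p = vertical_pairing d r (trans c d p).
Proof.
move=> cc cd C1r Op; have [Ac confc] := cc; have [Ad confd] := cd.
have [ip _ it iE] := overlapP Op.
have [cxy cxy0] := confc _ ip; have [dxy dxy0] := confd _ it.
have rE q : overlap c d q -> (r \o icoord c) q = (r \o icoord d) (trans c d q).
  by move=> /overlapP[_ _ _ E]; rewrite /= -E.
have [ex ey] := dx_change Ac Ad C1r rE Op.
rewrite /vertical_pairing ex ey.
exact: (pairing_frame_change _ _ _ (frame_change Ac Ad Op) cxy cxy0 dxy dxy0
  (lt0r_neq0 (e2alpha_gt0 immf Ac ip))).
Qed.

End ChangeOfChart.

(** * Continuity of the curvatures in a conformal parameter *)

Section Continuity.
Variable R : realType.

Lemma continuous_sum (I : finType) (F : I -> R * R -> R) p :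
  (forall i, {for p, continuous (F i)}) ->
  {for p, continuous (fun q => \sum_i F i q)}.
Proof.
move=> Fc; elim: (index_enum I) => [|i s IH].
  have -> : (fun q => \sum_(i <- [::]) F i q) = cst 0.
    by apply/funext => q; rewrite big_nil.
  exact: cst_continuous.
have -> : (fun q => \sum_(i <- i :: s) F i q) =
    (fun q => F i q + \sum_(i <- s) F i q).
  by apply/funext => q; rewrite big_cons.
by apply: continuousD.
Qed.

Lemma continuous_nabla (u v : R * R -> 'rV[R]_3) p k :
  (forall j, {for p, continuous (fun q => u q 0 j)}) ->
  (forall j, {for p, continuous (fun q => v q 0 j)}) ->
  {for p, continuous (fun q => nabla (u q) (v q) 0 k)}.
Proof.
move=> uc vc.
have -> : (fun q => nabla (u q) (v q) 0 k) = (fun q => \sum_i \sum_j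
    u q 0 i * v q 0 j * christoffel R i j k).
  by apply/funext => q; rewrite nabla_sumE.
apply: continuous_sum => i; apply: continuous_sum => j.
by apply: continuousM; [apply: continuousM|exact: cst_continuous].
Qed.

Lemma continuous_cross (u v : R * R -> 'rV[R]_3) p k :
  (forall j, {for p, continuous (fun q => u q 0 j)}) ->
  (forall j, {for p, continuous (fun q => v q 0 j)}) ->
  {for p, continuous (fun q => cross (u q) (v q) 0 k)}.
Proof.
move=> uc vc.
have -> : (fun q => cross (u q) (v q) 0 k) = (fun q =>
    u q 0 (k + 1) * v q 0 (k + 2) - u q 0 (k + 2) * v q 0 (k + 1)).
  by apply/funext => q; rewrite cross_succE.
by apply: continuousB; apply: continuousM.
Qed.

Variables (G : universal_cover_SL2 R).
Variables (M : closed_oriented_surface R) (f : M -> G).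
Hypothesis immf : immersion f.
Variables (c : chart R M) (H : M -> R) (Khat : M -> R).
Hypotheses (cc : conformal_parameter f c) (mcH : mean_curvature f H).
Hypothesis tsK : tangent_sectional_curvature f Khat.
Let Ac := conformal_atlas cc.

Lemma continuous_fx k p : img c p -> {for p, continuous (fun q => fx f c q 0 k)}.
Proof. by move=> ip; have [h _ _ _] := fx_C1 immf k Ac; exact: h. Qed.

Lemma continuous_fy k p : img c p -> {for p, continuous (fun q => fy f c q 0 k)}.
Proof. by move=> ip; have [h _ _ _] := fy_C1 immf k Ac; exact: h. Qed.

Lemma continuous_e2alpha p : img c p -> {for p, continuous (e2alpha f c)}.
Proof. by move=> ip; have [h _ _ _] := e2alpha_C1 immf Ac; exact: h. Qed.

Lemma continuous_e2alphaV p : img c p -> {for p, continuous (fun q => (e2alpha f c q)^-1)}.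
Proof.
move=> ip; apply: continuousV; last exact: continuous_e2alpha.
exact: lt0r_neq0 (e2alpha_gt0 immf Ac ip).
Qed.

Lemma continuous_re_nabla k p : img c p -> {for p, continuous (re_nabla f c k)}.
Proof.
move=> ip; have [_ _ fxx _] := fx_C1 immf k Ac; have [_ _ _ fyy] := fy_C1 immf k Ac.
apply: continuousM; first exact: cst_continuous.
apply: continuousD; last first.
  by apply: continuous_nabla => j; exact: continuous_fy.
apply: continuousD; last first.
  by apply: continuous_nabla => j; exact: continuous_fx.
by apply: continuousD; [exact: fxx|exact: fyy].
Qed.

Lemma continuous_mean_curvature p : img c p -> {for p, continuous (H \o icoord c)}.
Proof.
move: p; apply: (@eq_continuous_on _ _ (fun q => 2 *
    (\sum_k re_nabla f c k q * cross (fx f c q) (fy f c q) 0 k) *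
    ((e2alpha f c q)^-1 * (e2alpha f c q)^-1))) => [|p ip|p ip].
- exact: open_img.
- by rewrite /= (mean_curvatureE immf cc mcH ip) -invfM expr2.
- have ev := continuous_e2alphaV ip.
  apply: continuousM; last exact: continuousM.
  apply: continuousM; first exact: cst_continuous.
  apply: continuous_sum => k; apply: continuousM; first exact: continuous_re_nabla.
  by apply: continuous_cross => j; [exact: continuous_fx|exact: continuous_fy].
Qed.

Lemma continuous_Khat p : img c p -> {for p, continuous (Khat \o icoord c)}.
Proof.
have ncont q : img c q -> {for q, continuous (fun q => cross (fx f c q) (fy f c q) 0 (1+1))}.
  move=> iq; apply: continuous_cross => j; [exact: continuous_fx|exact: continuous_fy].
move: p; apply: (@eq_continuous_on _ _ (fun q => 1 -
    5 * (cross (fx f c q) (fy f c q) 0 (1+1) * cross (fx f c q) (fy f c q) 0 (1+1)) *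
    ((e2alpha f c q)^-1 * (e2alpha f c q)^-1))) => [|p ip|p ip].
- exact: open_img.
- by rewrite /= (Khat_chart immf cc tsK ip) -invfM !expr2.
- have ev := continuous_e2alphaV ip.
  apply: continuousB; first exact: cst_continuous.
  apply: continuousM; last exact: continuousM.
  apply: continuousM; first exact: cst_continuous.
  by apply: continuousM; exact: ncont.
Qed.

End Continuity.

(** * Integration over the surface *)

Section SurfaceIntegral.
Variables (R : realType) (G : universal_cover_SL2 R).
Variables (M : closed_oriented_surface R) (f : M -> G).
Variable mu : {measure set (borel M) -> \bar R}.
Hypotheses (immf : immersion f) (muf : area_measure f mu).
Local Notation R2 := (measurableTypeR R * measurableTypeR R)%type.
Local Notation BM := (borel M).

Lemma open_borel (W : set M) : open W -> measurable (W : set BM).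
Proof. by move=> oW; exact: sub_sigma_algebra. Qed.

Section OneChart.
Variables (c : chart R M) (h : M -> R) (K : set M).
Hypotheses (cc : conformal_parameter f c) (cK : compact K) (Kc : K `<=` dom c).
Hypothesis hc : forall p, img c p -> {for p, continuous (h \o icoord c)}.
Hypothesis h0 : forall q, dom c q -> ~ K q -> h q = 0.
Let Ac := conformal_atlas cc.

Lemma measurable_icoord : measurable_fun (img c : set R2) (icoord c : R2 -> BM).
Proof.
apply: (@measurability _ _ _ BM _ _ (@open M)) => [//|_ [W oW <-]].
by apply: open_plane_measurable; exact: icoord_open.
Qed.

Lemma measurable_dom_chart : measurable_fun (dom c : set BM) (h : BM -> R).
Proof.
apply: measurable_fun_open; first by apply: open_borel; exact: dom_open.
move=> B oB; apply: open_borel.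
have oI : open (img c `&` (h \o icoord c) @^-1` B).
  rewrite openE => p [ip Bp]; apply: filterI.
    exact: (open_nbhs_nbhs (conj (open_img c) ip)).
  by apply: (hc ip); exact: open_nbhs_nbhs.
have -> : dom c `&` h @^-1` B =
    dom c `&` coord c @^-1` (img c `&` (h \o icoord c) @^-1` B).
  apply/seteqP; split=> q [Dq hq]; split=> //=.
    by split; [exact: coord_img|rewrite /= domK].
  by case: hq => _; rewrite /= domK.
exact: coord_open.
Qed.

(** The transfer lemmas with the inverse chart as map and e^(2 alpha) as weight; the compact support
    of [h] gives integrability in the plane. *)
Lemma surface_chart_integral :
  mu.-integrable (dom c) (EFin \o (h : BM -> R)) /\
  (\int[mu]_(q in dom c) (h q)%:E =
   \int[@area2 R]_(p in img c) (h (icoord c p) * e2alpha f c p)%:E)%E.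
Proof.
have oc := open_img c.
have mD : measurable (dom c : set BM) by apply: open_borel; exact: dom_open.
have mO : measurable (img c : set R2) := open_plane_measurable oc.
have mw : measurable_fun (img c : set R2) (e2alpha f c : R2 -> R).
  by apply: continuous_plane_measurable => // p ip; exact: (continuous_e2alpha immf cc).
have w0 p : img c p -> 0 <= e2alpha f c p by move=> ip; exact/ltW/(e2alpha_gt0 immf Ac).
have muE (B : set BM) : measurable B -> B `<=` dom c ->
    mu B = (\int[@area2 R]_(x in img c `&` icoord c @^-1` B) (e2alpha f c x)%:E)%E.
  by move=> mB Bc; rewrite (muf cc mB Bc) img_preimageE.
have mh : measurable_fun (dom c : set BM) (EFin \o (h : BM -> R)).
  by apply/measurable_EFinP; exact: measurable_dom_chart.
have phiD : forall p, img c p -> dom c (icoord c p) by exact: icoord_dom.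
split; last first.
  exact: (integral_density mD mO measurable_icoord phiD mw w0 muE mh).
apply: (integrable_density mD mO measurable_icoord phiD mw w0 muE mh).
have := @integrable_open_compact R (img c) (coord c @` K)
  (fun p => h (icoord c p) * e2alpha f c p) oc (coord_compact cK Kc).
apply.
- by move=> _ [q Kq <-]; exact/coord_img/Kc.
- move=> p ip; apply: continuousM; first exact: hc.
  exact: (continuous_e2alpha immf cc).
- move=> p ip Kp; rewrite h0 ?mul0r //; first exact: icoord_dom.
  by move=> Kq; apply: Kp; exists (icoord c p) => //; exact: icoordK.
Qed.

End OneChart.
End SurfaceIntegral.

(** Integrability of the partial sums is carried through the induction, since additivity of the
    real-valued integral requires it. *)
Lemma Rintegral_sum d (T : measurableType d) (R : realType)
    (mu : {measure set T -> \bar R}) (D : set T) (I : Type) (s : seq I)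
    (h : I -> T -> R) :
    measurable D -> (forall i, mu.-integrable D (EFin \o h i)) ->
  mu.-integrable D (EFin \o (fun x => \sum_(i <- s) h i x)) /\
  \int[mu]_(x in D) (\sum_(i <- s) h i x) =
    \sum_(i <- s) \int[mu]_(x in D) h i x.
Proof.
move=> mD ih; elim: s => [|i s [IH1 IH2]].
  have E : (fun x => \sum_(i <- [::]) h i x) = cst 0.
    by apply/funext => x; rewrite big_nil.
  rewrite E big_nil; split; first exact: integrable0.
  by rewrite /Rintegral integral0.
have E : (fun x => \sum_(i <- i :: s) h i x) = (fun x => h i x + \sum_(j <- s) h j x).
  by apply/funext => x; rewrite big_cons.
rewrite E big_cons -IH2; split; last exact: RintegralD.
by apply: eq_integrable (integrableD mD (ih i) IH1).
Qed.

(** * Integration by parts in an open subset of the plane *)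

Section IntegrationByParts.
Variables (R : realType) (O K : set (R * R)) (r x y : R * R -> R).
Hypotheses (oO : open O) (cK : compact K) (KO : K `<=` O).
Hypotheses (C1r : C1 O r) (C1x : C1 O x) (C1y : C1 O y).
Hypothesis r0 : forall p, O p -> ~ K p -> r p = 0.
Local Notation R2 := (measurableTypeR R * measurableTypeR R)%type.

Let outside g p : (forall p, O p -> ~ K p -> g p = 0) -> O p -> ~ K p ->
  dx g p = 0 /\ dy g p = 0.
Proof.
move=> g0 Op Kp; apply: (@open_support_dx_dy _ (O `&` ~` K)) => //.
  by apply: openI => //; exact: compact_plane_open.
by move=> q [Oq Kq]; exact: g0.
Qed.

Let div p := r p * (dx x p + dy y p).
Let grad p := dx r p * x p + dy r p * y p.

Lemma integrable_div : (@area2 R).-integrable (O : set R2) (EFin \o (div : R2 -> R)).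
Proof.
have [rc _ _ _] := C1r; have [_ _ xx _] := C1x; have [_ _ _ yy] := C1y.
apply: (integrable_open_compact oO cK KO) => p Op.
  apply: continuousM; first exact: rc.
  by apply: continuousD; [exact: xx|exact: yy].
by move=> Kp; rewrite /div r0 // mul0r.
Qed.

(** [x] and [y] may misbehave near the boundary of [O]; the products with the cutoff [r] are the
    functions to which vanishing of the integrated derivatives applies. *)
Lemma Rintegral_by_parts :
  \int[@area2 R]_(p in O) div p = - \int[@area2 R]_(p in O) grad p.
Proof.
have [rc rd rx ry] := C1r; have [xc xd _ _] := C1x; have [yc yd _ _] := C1y.
have mO : measurable (O : set R2) := open_plane_measurable oO.
pose g1 p := r p * x p; pose g2 p := r p * y p.
have C1g1 : C1 O g1 by exact: (C1M oO C1r C1x).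
have C1g2 : C1 O g2 by exact: (C1M oO C1r C1y).
have g10 p : O p -> ~ K p -> g1 p = 0 by move=> Op Kp; rewrite /g1 r0 // mul0r.
have g20 p : O p -> ~ K p -> g2 p = 0 by move=> Op Kp; rewrite /g2 r0 // mul0r.
have [I1 _] := Rintegral_dx_dy0 oO cK KO C1g1 g10.
have [_ I2] := Rintegral_dx_dy0 oO cK KO C1g2 g20.
have [_ _ g1x _] := C1g1; have [_ _ _ g2y] := C1g2.
have i1 : (@area2 R).-integrable (O : set R2) (EFin \o (dx g1 : R2 -> R)).
  apply: (integrable_open_compact oO cK KO g1x) => p Op Kp.
  exact: (outside g10 Op Kp).1.
have i2 : (@area2 R).-integrable (O : set R2) (EFin \o (dy g2 : R2 -> R)).
  apply: (integrable_open_compact oO cK KO g2y) => p Op Kp.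
  exact: (outside g20 Op Kp).2.
have ig : (@area2 R).-integrable (O : set R2) (EFin \o (grad : R2 -> R)).
  apply: (integrable_open_compact oO cK KO) => p Op.
    by apply: continuousD; apply: continuousM;
      [exact: rx|exact: xc|exact: ry|exact: yc].
  by move=> Kp; have [ex ey] := outside r0 Op Kp; rewrite /grad ex ey !mul0r addr0.
have iS : (@area2 R).-integrable (O : set R2)
    (EFin \o ((fun p => dx g1 p + dy g2 p) : R2 -> R)).
  exact: (integrableD mO i1 i2).
have E p : p \in O -> div p = dx g1 p + dy g2 p - grad p.
  rewrite inE => Op; have [r1 r2] := rd p Op.
  have -> : dx g1 p = r p * dx x p + x p * dx r p by exact: dxM r1 (xd p Op).1.
  have -> : dy g2 p = r p * dy y p + y p * dy r p by exact: dyM r2 (yd p Op).2.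
  by rewrite /div /grad; ring.
rewrite (eq_Rintegral (D := O : set R2) _ E) RintegralB //.
by rewrite RintegralD // I1 I2 addr0 sub0r.
Qed.

End IntegrationByParts.

Lemma Re_realM (R : rcfType) (a : R) (z : R[i]) :
  complex.Re (a%:C * z) = a * complex.Re z.
Proof. by case: z => x y; simpc. Qed.

Lemma Im_realM (R : rcfType) (a : R) (z : R[i]) :
  complex.Im (a%:C * z) = a * complex.Im z.
Proof. by case: z => x y; simpc. Qed.

(** * One summand of the energy as integrals over the surface *)

Section Assembly.
Variables (R : realType) (G : universal_cover_SL2 R).
Variables (M : closed_oriented_surface R) (f : M -> G).
Variable mu : {measure set (borel M) -> \bar R}.
Hypotheses (immf : immersion f) (muf : area_measure f mu).
Local Notation R2 := (measurableTypeR R * measurableTypeR R)%type.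
Local Notation BM := (borel M).

Lemma surface_integral c (K : set M) (h : M -> R) :
    conformal_parameter f c -> compact K -> K `<=` dom c ->
    (forall p, img c p -> {for p, continuous (h \o icoord c)}) ->
    (forall q, ~ K q -> h q = 0) ->
  mu.-integrable setT (EFin \o (h : BM -> R)) /\
  \int[mu]_q h q = \int[@area2 R]_(p in img c) (h (icoord c p) * e2alpha f c p).
Proof.
move=> cc cK Kc hc h0.
have [ih hE] := surface_chart_integral immf muf cc cK Kc hc (fun q _ => h0 q).
have mD : measurable (dom c : set BM) by apply: open_borel; exact: dom_open.
have restrE : (EFin \o (h : BM -> R)) \_ (dom c) = EFin \o h.
  apply/funext => q; rewrite patchE; case: ifPn => // /negP qD.
  by rewrite /= h0 // => /Kc Dq; apply: qD; rewrite inE.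
split; first by move/(integrable_mkcond _ mD): ih; rewrite restrE.
rewrite /Rintegral -hE [in RHS]integral_mkcond.
congr (fine _); apply: eq_integral => x _.
exact: esym (congr1 (fun g => g x) restrE).
Qed.

(** [K] may reach beyond the domain of [c], so the support of one cutoff can be inspected in the
    chart of another. *)
Lemma chart_support c (K : set M) (g : R * R -> R) p : closed K ->
    (forall p, img c p -> ~ K (icoord c p) -> g p = 0) ->
    img c p -> ~ K (icoord c p) ->
  dx g p = 0 /\ dy g p = 0.
Proof.
move=> clK g0 ip Kp.
apply: (@open_support_dx_dy _ (img c `&` icoord c @^-1` (~` K))) => //.
  by apply: icoord_open; rewrite openC.
by move=> q [iq Kq]; exact: g0.
Qed.

Variables (H Khat : M -> R).
Hypotheses (mcH : mean_curvature f H) (tsK : tangent_sectional_curvature f Khat).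

Let density m := 4^-1 * (H m ^+ 2 + 5 / 16 * Khat m - 4^-1).

Section OneTerm.
Variables (c : chart R M) (rho : M -> R) (psi1 psi2 : R * R -> R[i]).
Hypotheses (cc : conformal_parameter f c) (gs : generating_spinor f c psi1 psi2).
Hypothesis rho1 : C1 (img c) (rho \o icoord c).
Let K := closure [set q | rho q != 0].
Hypothesis Kc : K `<=` dom c.
Let Ac := conformal_atlas cc.

Let clK : closed K. Proof. exact: closed_closure. Qed.

Let cK : compact K.
Proof. exact: subclosed_compact clK (@surf_compact R M) _. Qed.

Lemma rho_out q : ~ K q -> rho q = 0.
Proof.
by move=> Kq; apply/eqP/negP => /negP rq; apply: Kq; exact: subset_closure.
Qed.

Let UV p := potentialU (H (icoord c p)) (psi1 p) (psi2 p) *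
  potentialV (H (icoord c p)) (psi1 p) (psi2 p).

(** The imaginary part - 5/8 H n_3 is turned into a divergence, which halves the coefficient to -
    5/16. *)
Lemma UV_chart p : img c p -> UV p =
  (density (icoord c p) * e2alpha f c p) +i*
  (- (5 / 16) * (dx (fun q => fx f c q 0 (1+1)) p + dy (fun q => fy f c q 0 (1+1)) p)).
Proof.
move=> ip; have [_ /(_ p ip)[xy xy0]] := cc; have [_ _ /(_ p ip)[Z0 Z1 Z2]] := gs.
rewrite /UV (energy_density (H (icoord c p)) xy xy0
  (lt0r_neq0 (e2alpha_gt0 immf Ac ip)) Z0 Z1 Z2).
rewrite -(tsK Ac ip) (divergence_vertical immf cc mcH ip).
by congr (_ +i* _); move: (cross _ _ 0 _) => m; field.
Qed.

(** Extended by zero to all of [M], so that the pairings from different charts can be added and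
    integrated against [mu] together. *)
Definition grad_pairing : M -> R :=
  (fun m => vertical_pairing f c rho (coord c m)) \_ (dom c).

Lemma density_integral :
  mu.-integrable setT (EFin \o ((fun m => rho m * density m) : BM -> R)) /\
  \int[@area2 R]_(p in img c) Re_ (fun p => (rho (icoord c p))%:C * UV p) p =
  \int[mu]_m (rho m * density m).
Proof.
have hc p : img c p -> {for p, continuous ((fun m => rho m * density m) \o icoord c)}.
  move=> ip; have Hc := continuous_mean_curvature immf cc mcH ip.
  have Kc' := continuous_Khat immf cc tsK ip; have [rc _ _ _] := rho1.
  apply: continuousM; first exact: rc.
  apply: continuousM; first exact: cst_continuous.
  apply: continuousB; last exact: cst_continuous.
  apply: continuousD; last by apply: continuousM => //; exact: cst_continuous.
  by apply: (continuousM Hc Hc).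
have [|ih ->] := surface_integral cc cK Kc hc.
  by move=> q Kq; rewrite rho_out // mul0r.
split=> //; apply: eq_Rintegral => p /[!inE] ip.
by rewrite /Re_ UV_chart // Re_realM mulrA.
Qed.

Lemma grad_pairing_chart p : img c p ->
  grad_pairing (icoord c p) = vertical_pairing f c rho p.
Proof.
move=> ip; rewrite /grad_pairing patchE ifT ?icoordK // inE.
exact: icoord_dom.
Qed.

Lemma vertical_pairing_out (d : chart R M) p : img d p -> ~ K (icoord d p) ->
  vertical_pairing f d rho p = 0.
Proof.
move=> ip Kp; have [|ex ey] := @chart_support d K (rho \o icoord d) p clK _ ip Kp.
  by move=> q _; exact: rho_out.
have z (a b x y e : R) : a = 0 -> b = 0 -> (a * x + b * y) / e = 0.
  by move=> -> ->; rewrite !mul0r addr0 mul0r.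
exact (z _ _ _ _ _ ex ey).
Qed.

Lemma grad_pairing_out q : ~ K q -> grad_pairing q = 0.
Proof.
move=> Kq; rewrite /grad_pairing patchE; case: ifPn => // /[!inE] Dq.
by rewrite vertical_pairing_out ?domK //; exact: coord_img.
Qed.

Lemma pairing_integral :
  mu.-integrable setT (EFin \o (grad_pairing : BM -> R)) /\
  \int[@area2 R]_(p in img c) Im_ (fun p => (rho (icoord c p))%:C * UV p) p =
  5 / 16 * \int[mu]_m grad_pairing m.
Proof.
have oc := open_img c; have [rc rd rx ry] := rho1.
have f1 := fx_C1 immf (1+1) Ac; have f2 := fy_C1 immf (1+1) Ac.
have [xc _ _ _] := f1; have [yc _ _ _] := f2.
have hc p : img c p -> {for p, continuous (grad_pairing \o icoord c)}.
  move: p; apply: (@eq_continuous_on _ _ (vertical_pairing f c rho)) => // p ip.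
    by rewrite /= grad_pairing_chart.
  apply: continuousM; last exact: (continuous_e2alphaV immf cc).
  by apply: continuousD; apply: continuousM; [exact: rx|exact: xc|exact: ry|exact: yc].
have [ih hE] := surface_integral cc cK Kc hc grad_pairing_out.
split=> //; rewrite hE.
have cKc := coord_compact cK Kc.
have KKc : coord c @` K `<=` img c by move=> _ [q Kq <-]; exact/coord_img/Kc.
have r0 p : img c p -> ~ (coord c @` K) p -> (rho \o icoord c) p = 0.
  move=> ip Kp; apply: rho_out => Kq; apply: Kp.
  by exists (icoord c p) => //; exact: icoordK.
have parts := Rintegral_by_parts oc cKc KKc rho1 f1 f2 r0.
have idiv := integrable_div oc cKc KKc rho1 f1 f2 r0.
have mI : measurable (img c : set R2) := open_plane_measurable oc.
(* The minus sign of the imaginary part and that of the integration by parts cancel. *)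
have key (A B C D : R) : A = - (5 / 16) * C -> C = - D -> D = B -> A = 5 / 16 * B.
  by move=> -> -> ->; rewrite mulrNN.
apply: key parts _; last first.
  (* The area density cancels the denominator of the pairing, leaving the flat expression produced
     by the integration by parts. *)
  apply: eq_Rintegral => p /[!inE] ip; rewrite grad_pairing_chart //.
  by rewrite /vertical_pairing mulfVK //; exact: lt0r_neq0 (e2alpha_gt0 immf Ac ip).
rewrite -(RintegralZl _ mI idiv); apply: eq_Rintegral => p /[!inE] ip.
by rewrite /Im_ Im_realM UV_chart // mulrCA.
Qed.

End OneTerm.
End Assembly.

Lemma sum_vertical_pairing0 (R : realType) (G : universal_cover_SL2 R)
    (M : closed_oriented_surface R) (f : M -> G) (I : finType)
    (rho : I -> M -> R) (c : chart R M) p :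
    (forall i, C1 (img c) (rho i \o icoord c)) ->
    (forall q, \sum_i rho i q = 1) -> img c p ->
  \sum_i vertical_pairing f c (rho i) p = 0.
Proof.
move=> rho1 sum1 ip.
(* Additivity of [dx] and [dy] needs derivability of the partial sum, so the induction also carries
   [C1]. *)
have D (s : seq I) : [/\ C1 (img c) (fun q => \sum_(i <- s) rho i (icoord c q)),
    dx (fun q => \sum_(i <- s) rho i (icoord c q)) p =
      \sum_(i <- s) dx (rho i \o icoord c) p &
    dy (fun q => \sum_(i <- s) rho i (icoord c q)) p =
      \sum_(i <- s) dy (rho i \o icoord c) p].
  elim: s => [|i s [C1s ex ey]].
    have -> : (fun q => \sum_(i <- [::]) rho i (icoord c q)) = cst 0.
      by apply/funext => q; rewrite big_nil.
    by split; rewrite ?big_nil; [exact: C1_cst|exact: derive_cst|exact: derive_cst].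
  have -> : (fun q => \sum_(i <- i :: s) rho i (icoord c q)) =
      (fun q => (rho i \o icoord c) q + \sum_(i <- s) rho i (icoord c q)).
    by apply/funext => q; rewrite big_cons.
  have [_ /(_ p ip)[d1 d2] _ _] := rho1 i; have [_ /(_ p ip)[d1' d2'] _ _] := C1s.
  rewrite !big_cons -ex -ey; split; first exact: C1D (open_img c) (rho1 i) C1s.
    exact: dxD.
  exact: dyD.
have [_ ex ey] := D (index_enum I).
have one : (fun q => \sum_i rho i (icoord c q)) = cst 1 by apply/funext => q.
rewrite one in ex ey.
have key (a b : I -> R) (x y e : R) : 0 = \sum_i a i -> 0 = \sum_i b i ->
    \sum_i (a i * x + b i * y) / e = 0.
  by move=> a0 b0; rewrite -mulr_suml big_split /= -!mulr_suml -a0 -b0 !mul0r addr0 mul0r.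
apply: key.
  by rewrite -ex; exact/esym/derive_cst.
by rewrite -ey; exact/esym/derive_cst.
Qed.

Theorem proposition7 (R : realType) (G : universal_cover_SL2 R)
    (M : closed_oriented_surface R) (f : M -> G)
    (H Khat : M -> R) (mu : {measure set (borel M) -> \bar R}) (E : R[i]) :
  immersion f ->
  mean_curvature f H ->
  tangent_sectional_curvature f Khat ->
  area_measure f mu ->
  energy f H E ->
  E = (4^-1 * \int[mu]_p (H p ^+ 2 + 5 / 16 * Khat p - 4^-1))%:C.
Proof.
move=> immf mcH tsK muf [n [c [rho [psi1 [psi2 [cc [rhos _ rhoK rho1] gs ->]]]]]].
have Ac i := conformal_atlas (cc i).
have C1rho i d : atlas d -> C1 (img d) (rho i \o icoord d).
  by move=> Ad; exact/smooth_C1/rhos.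
have rc i := C1rho i _ (Ac i).
pose density m := 4^-1 * (H m ^+ 2 + 5 / 16 * Khat m - 4^-1).
pose grad i := grad_pairing f (c i) (rho i).
have dens i := density_integral immf muf mcH tsK (cc i) (gs i) (rc i) (rhoK i).
have pair i := pairing_integral immf muf mcH tsK (cc i) (gs i) (rc i) (rhoK i).
have grad0 m : \sum_i grad i m = 0.
  (* All pairings at [m] are to be evaluated in one chart. A cutoff nonzero at [m] exists because
     the sum is 1, and its chart contains [m]. *)
  have [j rj] : exists j, rho j m != 0.
    apply/existsP; rewrite -negb_forall; apply/negP => /forallP r0.
    have := rho1 m; rewrite big1 => [/eqP|i _]; last exact/eqP/r0.
    by rewrite eq_sym oner_eq0.
  have Dj : dom (c j) m by apply: rhoK; exact: subset_closure.
  rewrite -[RHS](sum_vertical_pairing0 f (fun i => C1rho i _ (Ac j)) rho1 (coord_img Dj)).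
  apply: eq_bigr => i _; rewrite /grad /grad_pairing patchE.
  case: ifPn => [/[!inE] Di|/negP Di].
    have Op : (coord (c i) @` (dom (c i) `&` dom (c j))) (coord (c i) m) by exists m.
    rewrite (vertical_pairing_change immf (cc i) (cc j) (C1rho i _ (Ac j)) Op) /=.
    by rewrite domK.
  (* Where chart [c i] is undefined, [m] lies off the closed support of [rho i], so the pairing
     computed in chart [c j] is 0 as well. *)
  rewrite (vertical_pairing_out f (rho := rho i)) //; first exact: coord_img.
  by rewrite domK // => /rhoK Di'; apply: Di; rewrite inE.
have mT : measurable [set: borel M] by [].
have [] := Rintegral_sum (index_enum 'I_n) mT (fun i => (dens i).1).
have -> : (fun m => \sum_i rho i m * density m) = density.
  by apply/funext => m; rewrite -mulr_suml rho1 mul1r.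
move=> idens redens.
have [_] := Rintegral_sum (index_enum 'I_n) mT (fun i => (pair i).1).
have -> : (fun m => \sum_i grad i m) = cst 0 by apply/funext.
rewrite /Rintegral integral0 /= => sum_grad.
have re : \sum_i \int[mu]_m (rho i m * density m) =
    4^-1 * \int[mu]_p (H p ^+ 2 + 5 / 16 * Khat p - 4^-1).
  rewrite -redens.
  (* The scalar is moved by way of [density], the function whose integrability [idens] provides. *)
  have -> : \int[mu]_p (H p ^+ 2 + 5 / 16 * Khat p - 4^-1) = 4 * \int[mu]_m density m.
    rewrite -(RintegralZl _ mT idens); apply: eq_Rintegral => m _.
    by rewrite /density mulrA mulfV // mul1r.
  by rewrite mulrA mulVf // mul1r.
have ext (z w : R[i]) : complex.Re z = complex.Re w -> complex.Im z = complex.Im w ->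
    z = w by case: z w => ? ? [? ?] /= -> ->.
apply: ext; rewrite ?Re_sum ?Im_sum.
  by apply: etrans re; apply: eq_bigr => i _; exact: (dens i).2.
transitivity (\sum_i 5 / 16 * \int[mu]_m grad i m).
  by apply: eq_bigr => i _; exact: (pair i).2.
by rewrite -mulr_sumr -sum_grad mulr0.
Qed.
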